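(* Let $(s,t)\in\mathbb{C}\times\mathbb{C}$ with $|s|^2>|t|^2+1$, and let $\gamma$ be the unique solution in the open unit disk of the equation $$\overline{st}\,\gamma^2+(|s|^2+|t|^2+1)\gamma+st=0.$$ Then for each nonnegative integer $n$ the positive number $$\lambda_n=\left(\frac{|s|}{|s|^2+\gamma\overline{st}}\right)^{2n+1}$$ is an eigenvalue of $\left|T^{(s,t)}\right|^2=(T^{(s,t)})^*T^{(s,t)}$ on $F^2$, and the function $Q_n(z)e^{\gamma z^2/2}$ is a corresponding eigenvector, where $$Q_n(z)=\int_{\mathbb{R}}H_n(x)\exp\left[-\nu(x-bz)^2\right]dx$$ is a polynomial of degree $n$. Here $H_n(x)$ is the classical Hermite polynomial of degree $n$, $$\nu=\frac{(|s|^2+\gamma\overline{st})^2\left[(|s|^2+\gamma\overline{st})^2+(\gamma+1)\overline{st}(|t|^2+1-|s|^2)/2\right]-|s|^4}{(|s|^2+\gamma\overline{st})^4-|s|^4},$$ and $b=\sqrt{\gamma+1}/(2\sqrt\nu)$.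
   Context: Let $d\lambda(z)=\frac1\pi e^{-|z|^2}\,dA(z)$ on $\mathbb{C}$. The Fock space $F^2$ is the Hilbert space of entire functions $f$ with $\int_{\mathbb{C}}|f|^2\,d\lambda<\infty$ and inner product $\langle f,g\rangle=\int_{\mathbb{C}}f\overline g\,d\lambda$. For $(s,t)\in\mathbb{C}^2$ with $s\ne0$, $$K^{(s,t)}(z,w)=\frac1{\sqrt s}\exp\left[\frac{tz^2-\overline{tw^2}+2z\overline w}{2s}\right],\qquad T^{(s,t)}f(z)=\int_{\mathbb{C}}K^{(s,t)}(z,w)f(w)\,d\lambda(w).$$ All complex square roots are principal: $\sqrt z=\sqrt{|z|}e^{i\theta/2}$ for $z=|z|e^{i\theta}$, $\theta\in(-\pi,\pi]$. It is known that $T^{(s,t)}$ is compact on $F^2$ when $|s|^2>|t|^2+1$. It is also known that under this hypothesis the quadratic (linear if $t=0$) equation for $\gamma$ has exactly one solution in the open unit disk. The Hermite polynomials are $H_n(x)=(-1)^ne^{x^2}\frac{d^n}{dx^n}e^{-x^2}$. *)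

(* Defs.v *)
(* MathComp-Analysis, with R[i] from mathcomp-real-closed as the complex field
   over an arbitrary R : realType. *)
From HB Require Import structures.
From mathcomp Require Import all_boot all_order all_algebra.
From mathcomp Require Import all_classical all_reals all_analysis.
From mathcomp Require Import complex.
From mathcomp Require Import ring lra.

Set Implicit Arguments.
Unset Strict Implicit.
Unset Printing Implicit Defensive.

Import Order.TTheory GRing.Theory Num.Theory.
Import numFieldNormedType.Exports.

Local Open Scope classical_set_scope.
Local Open Scope complex_scope.
Local Open Scope ring_scope.

Section ComplexAnalysis.
Context {R : realType}.
Implicit Types (z w : R[i]).

Definition cexp z : R[i] :=
  (expR (complex.Re z) * cos (complex.Im z))
    +i* (expR (complex.Re z) * sin (complex.Im z)).

Section Integral.
Context d (T : measurableType d) (mu : {measure set T -> \bar R}).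

Definition cintegrable (f : T -> R[i]) : Prop :=
  mu.-integrable setT (fun x => (complex.Re (f x))%:E) /\
  mu.-integrable setT (fun x => (complex.Im (f x))%:E).

Definition cintegral (f : T -> R[i]) : R[i] :=
  (\int[mu]_x complex.Re (f x)) +i* (\int[mu]_x complex.Im (f x)).

End Integral.

(* Area measure on C, carried by R * R through (x, y) |-> x +i* y. *)
Definition area
    : {measure set (measurableTypeR R * measurableTypeR R) -> \bar R} :=
  (@lebesgue_measure R \x @lebesgue_measure R)%E.

(* Density of the Gaussian measure of the Fock space with respect to area. *)
Definition gauss_weight (p : R * R) : R :=
  pi^-1 * expR (- (p.1 ^+ 2 + p.2 ^+ 2)).

Definition gauss_cintegral (f : R[i] -> R[i]) : R[i] :=
  cintegral area (fun p => (gauss_weight p)%:C * f (p.1 +i* p.2)).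

(* The scalar field of R[i]^o is R[i], so this is complex differentiability. *)
Definition entire (f : R[i] -> R[i]) : Prop :=
  forall z, derivable (f : R[i]^o -> R[i]^o) z 1.

(* [sqrtc] is the principal square root. *)
Lemma sqrtc_polar (r theta : R) : 0 <= r -> - pi < theta <= pi ->
  sqrtc (r%:C * cexp (0 +i* theta)) =
  (Num.sqrt r)%:C * cexp (0 +i* (theta / 2)).
Proof.
move=> r0 /andP[tlt tle].
rewrite /cexp /= expR0 !mul1r.
have tE : theta = (theta / 2) *+ 2 by field.
have cosE : cos theta = cos (theta / 2) ^+ 2 *+ 2 - 1.
  by rewrite -cos_mulr2n -tE.
have sinE : sin theta = (cos (theta / 2) * sin (theta / 2)) *+ 2.
  by rewrite -sin_mulr2n -tE.
have cs := cos2Dsin2 (theta / 2).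
have c0 : 0 <= cos (theta / 2) by apply: cos_ge0_pihalf; apply/andP; split; lra.
have sq1 : cos (theta / 2) = 0 -> sin (theta / 2) = 1.
  move=> c00; case: (ltrP theta pi) => tpi.
    have : 0 < cos (theta / 2) by apply: cos_gt0_pihalf; apply/andP; split; lra.
    by rewrite c00 ltxx.
  have -> : theta = pi by apply/eqP; rewrite eq_le tle.
  exact: sin_pihalf.
rewrite cosE sinE.
set c := cos _ in cs c0 sq1 *; set q := sin _ in cs sq1 *.
rewrite /real_complex_def /sqrtc !mul0r !subr0 !addr0.
have -> : (r * (c ^+ 2 *+ 2 - 1)) ^+ 2 + (r * (c * q *+ 2)) ^+ 2 = r ^+ 2.
  have -> : (r * (c ^+ 2 *+ 2 - 1)) ^+ 2 + (r * (c * q *+ 2)) ^+ 2 =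
            r ^+ 2 * (1 + 4%:R * c ^+ 2 * (c ^+ 2 + q ^+ 2 - 1)) by ring.
  by rewrite cs subrr mulr0 addr0 mulr1.
rewrite sqrtr_sqr ger0_norm //.
have -> : (r + r * (c ^+ 2 *+ 2 - 1)) / 2 = r * c ^+ 2 by field.
have -> : (r - r * (c ^+ 2 *+ 2 - 1)) / 2 = r * q ^+ 2.
  have -> : q ^+ 2 = 1 - c ^+ 2 by rewrite -cs; ring.
  by field.
rewrite !(sqrtrM _ r0) !sqrtr_sqr (ger0_norm c0).
congr (_ +i* _); rewrite mul0r ?subr0 ?addr0 //.
move: r0; rewrite le_eqVlt => /predU1P[<-|r0]; first by rewrite sqrtr0 !mul0r ?mulr0.
have [cz|cn0] := eqVneq c 0.
  by rewrite cz mul0r mul0rn mulr0 eqxx mul1r sq1 // normr1.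
have cp : 0 < c by rewrite lt_neqAle eq_sym cn0.
have kp : 0 < r * c *+ 2 by rewrite mulrn_wgt0 // mulr_gt0.
have -> : r * (c * q *+ 2) = (r * c *+ 2) * q by ring.
rewrite mulf_eq0 (gt_eqF kp) /= sgrM gtr0_sg // mul1r.
case: eqVneq => [->|qn0]; first by rewrite normr0 !mulr0.
by rewrite mulrCA -numEsg.
Qed.

End ComplexAnalysis.

Section FockSpace.
Context {R : realType}.
Implicit Types (s t : R[i]) (f g h : R[i] -> R[i]).

Definition fock : set (R[i] -> R[i]) :=
  [set f | entire f /\
    (\int[area]_p (gauss_weight p * Normc.normc (f (p.1 +i* p.2)) ^+ 2)%:E
       < +oo)%E].

Definition fock_dot f g : R[i] := gauss_cintegral (fun z => f z * (g z)^*).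

(* The adjoint on the Fock space of an operator A: for g in the Fock space,
   [fock_adjoint A g] is the (necessarily unique) h in the Fock space such that
   <A f, g> = <f, h> for all f in the Fock space, and a junk value (0) if there
   is no such h.  Operators are given by their action on all functions, but only
   their restriction to the Fock space matters. *)
Definition fock_adjoint (A : (R[i] -> R[i]) -> (R[i] -> R[i])) g : R[i] -> R[i] :=
  xget (fun=> 0)
    [set h | [/\ fock g, fock h &
                 forall f, fock f -> fock_dot (A f) g = fock_dot f h]].

Definition fock_eigenvector (A : (R[i] -> R[i]) -> (R[i] -> R[i]))
    (a : R[i]) f : Prop :=
  [/\ fock f, f <> (fun=> 0) & A f = (fun z => a * f z)].

Definition fock_eigenvalue (A : (R[i] -> R[i]) -> (R[i] -> R[i]))
    (a : R[i]) : Prop :=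
  exists f, fock_eigenvector A a f.

Definition kernelST s t (z w : R[i]) : R[i] :=
  (sqrtc s)^-1 *
  cexp ((t * z ^+ 2 - (t * w ^+ 2)^* + 2 * z * w^*) / (2 * s)).

Definition opST s t f : R[i] -> R[i] :=
  fun z => gauss_cintegral (fun w => kernelST s t z w * f w).

Definition absopST_sq s t f : R[i] -> R[i] :=
  fock_adjoint (opST s t) (opST s t f).

End FockSpace.

Definition hermite (R : realType) (n : nat) (x : R) : R :=
  (-1) ^+ n * expR (x ^+ 2) * derive1n n (fun y : R => expR (- y ^+ 2)) x.

Definition Qintegrand (R : realType) (n : nat) (nu b z : R[i]) (x : R) : R[i] :=
  (hermite n x)%:C * cexp (- nu * (x%:C - b * z) ^+ 2).

Definition Qfun (R : realType) (n : nat) (nu b z : R[i]) : R[i] :=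
  cintegral (@lebesgue_measure R) (Qintegrand n nu b z).

(* Main.v *)
(* Let P_n^k be the Hermite-type polynomials with generating function
   exp (u x + k u^2 / 2).  Integrating P_n^k (al x + eta) against
   exp (- A x^2 + B x) on the line gives a Gaussian constant times
   P_n^(k + al^2 / 2A) (eta + al B / 2A): integration by parts yields the
   three-term recurrence in n, and two linear differential equations (in B, and
   along Re A = constant) give the case n = 0.  Used once this shows that Q_n is a
   multiple of P_n^kappa; used twice, through Fubini, it shows that an integral
   operator with kernel exp of a quadratic form in (z, conj w) maps
   P_n^k (w) exp (ga w^2 / 2) to a multiple of a function of the same shape.
   T and T^* are both of this kind, and the equation for gamma says exactly that
   T^* T fixes gamma and kappa, whence the eigenvalue.

   The quadratic form in the exponent of the kernel is sqrt ((|t|^2 + 1) / |s|^2)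
   times a symmetric unitary form, hence for |s|^2 > |t|^2 + 1 the kernel against
   the two Gaussian weights is dominated by exp (- eps (|z|^2 + |w|^2)).  All the
   exchanges of integrals needed to identify the adjoint follow from this. *)
Require Import Defs.
From HB Require Import structures.
From mathcomp Require Import all_boot all_order all_algebra.
From mathcomp Require Import all_classical all_reals all_analysis.
From mathcomp Require Import complex.
From mathcomp Require Import measurable_realfun ring lra.
Set Implicit Arguments.
Unset Strict Implicit.
Unset Printing Implicit Defensive.
Import Order.TTheory GRing.Theory Num.Theory.
Import numFieldNormedType.Exports.
Local Open Scope classical_set_scope.
Local Open Scope complex_scope.
Local Open Scope ring_scope.

(** The recurring obstacle is the branch of complex square roots: the integral of [cgauss A 0] is a
    root of pi / A. For non-real A only products of two such integrals are evaluated, and these are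
    free of branches. Likewise only the squared modulus of [sqrtc s] survives in T^* T, and [b]
    matters through [b ^+ 2] and a nonzero factor. The determinant d = 1 + gamma conj(t) / s of the
    plane integral is real and positive because of the equation for gamma: multiplied by conj(st) it
    becomes a quadratic with real coefficients for X = gamma conj(st), and |X| <= |s||t| leaves no
    room for an imaginary part. Then a = |s|^2 + X exceeds |s|, and d = a / |s|^2. T sends gamma to
    - gamma conj(s) / s, of the same modulus, and T^* sends this back. On the Hermite parameter T^*
    T acts by an affine map with fixed point kappa; the stated nu equals 1 - (gamma + 1) kappa / 2,
    the value that gives Q_n the parameter kappa. The eigenvalue collects 1 / |s| from the root of
    s, 1 / d from the two plane integrals, and (|s| / a)^(2n) from rescaling the Hermite
    argument. *)

Notation Re := complex.Re.
Notation Im := complex.Im.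
Notation normc := Normc.normc.

(** * Real and imaginary parts, modulus and exponential of complex numbers *)

Section ComplexBasics.
Context {R : realType}.
Implicit Types (z w : R[i]) (r : R).

Lemma complexP z w : Re z = Re w -> Im z = Im w -> z = w.
Proof. by case: z w => [a b] [c d] /= -> ->. Qed.

Lemma ReD z w : Re (z + w) = Re z + Re w. Proof. by case: z w => ? ? []. Qed.
Lemma ImD z w : Im (z + w) = Im z + Im w. Proof. by case: z w => ? ? []. Qed.
Lemma ReN z : Re (- z) = - Re z. Proof. by case: z. Qed.
Lemma ImN z : Im (- z) = - Im z. Proof. by case: z. Qed.
Lemma ReM z w : Re (z * w) = Re z * Re w - Im z * Im w.
Proof. by case: z w => ? ? []. Qed.
Lemma ImM z w : Im (z * w) = Re z * Im w + Im z * Re w.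
Proof. by case: z w => ? ? []. Qed.
Lemma ReJ z : Re z^* = Re z. Proof. by case: z. Qed.
Lemma ImJ z : Im z^* = - Im z. Proof. by case: z. Qed.
Definition reimE := (ReD, ImD, ReN, ImN, ReM, ImM, ReJ, ImJ).

Lemma normcE z : `|z| = (normc z)%:C. Proof. by case: z. Qed.

Lemma conjC_real r : (r%:C)^* = r%:C :> R[i].
Proof. by apply: complexP; rewrite ?reimE //= oppr0. Qed.

Lemma conjC_mul z w : (z * w)^* = z^* * w^*.
Proof. exact: rmorphM. Qed.

Lemma normc_ge0 z : 0 <= normc z.
Proof. by case: z => a b; exact: sqrtr_ge0. Qed.

Lemma normc_sqr z : normc z ^+ 2 = Re z ^+ 2 + Im z ^+ 2.
Proof. by case: z => a b; rewrite sqr_sqrtr // addr_ge0 ?sqr_ge0. Qed.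

Lemma normc_Re_le z : `|Re z| <= normc z.
Proof.
rewrite -sqrtr_sqr; case: z => a b; apply: ler_wsqrtr => /=.
by rewrite lerDl sqr_ge0.
Qed.

Lemma normc_Im_le z : `|Im z| <= normc z.
Proof.
rewrite -sqrtr_sqr; case: z => a b; apply: ler_wsqrtr => /=.
by rewrite lerDr sqr_ge0.
Qed.

Lemma normc_le_ReIm z : normc z <= `|Re z| + `|Im z|.
Proof.
rewrite -[leRHS]ger0_norm ?addr_ge0 // -[leRHS]sqrtr_sqr.
case: z => a b; apply: ler_wsqrtr => /=; rewrite sqrrD !real_normK ?num_real //.
by rewrite -addrA lerD2l lerDr mulrn_wge0 // mulr_ge0.
Qed.

Lemma normc_real r : normc r%:C = `|r|.
Proof. by rewrite /= expr0n /= addr0 sqrtr_sqr. Qed.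

Lemma normcJ z : normc z^* = normc z.
Proof. by case: z => a b /=; rewrite sqrrN. Qed.

Lemma normcM z w : normc (z * w) = normc z * normc w.
Proof. exact: Normc.normcM. Qed.

Lemma normcX z n : normc (z ^+ n) = normc z ^+ n.
Proof.
by elim: n => [|n IH]; [exact: Normc.normc1 | rewrite !exprS normcM IH].
Qed.

Lemma ler_normcD z w : normc (z + w) <= normc z + normc w.
Proof. exact: le_normcD. Qed.

Lemma normcN z : normc (- z) = normc z.
Proof. by case: z => a b /=; rewrite !sqrrN. Qed.

Lemma normc_gt0 z : (0 < normc z) = (z != 0).
Proof.
apply/idP/idP => [|z0]; first by apply: contraTneq => ->; rewrite Normc.normc0 ltxx.
rewrite lt_neqAle normc_ge0 andbT; apply: contra z0 => /eqP z0.
by apply/eqP/Normc.eq0_normc.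
Qed.

Lemma cexp0 : cexp (0 : R[i]) = 1.
Proof. by apply: complexP; rewrite /cexp /= expR0 ?cos0 ?sin0 mul1r. Qed.

Lemma cexpD z w : cexp (z + w) = cexp z * cexp w.
Proof.
by apply: complexP; rewrite /cexp !reimE /= expRD ?cosD ?sinD; ring.
Qed.

Lemma cexp_real r : cexp r%:C = (expR r)%:C.
Proof. by apply: complexP; rewrite /cexp /= ?cos0 ?sin0 ?mulr1 ?mulr0. Qed.

Lemma cexpJ z : cexp z^* = (cexp z)^*.
Proof.
by apply: complexP; rewrite !reimE /cexp /= !reimE ?cosN // sinN mulrN.
Qed.

Lemma normc_cexp z : normc (cexp z) = expR (Re z).
Proof.
by rewrite /cexp /= !exprMn -mulrDr cos2Dsin2 mulr1 sqrtr_sqr ger0_norm ?expR_ge0.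
Qed.

Lemma cexp_neq0 z : cexp z != 0.
Proof. by rewrite -normc_gt0 normc_cexp expR_gt0. Qed.

End ComplexBasics.

(** * Derivatives of complex-valued functions of a real variable *)

Section RealVariableDerivative.
Context {R : realType}.
Implicit Types (f g : R -> R[i]) (x : R) (l m : R[i]).

Definition is_cderive f x l : Prop :=
  is_derive x 1 (fun y => Re (f y)) (Re l) /\
  is_derive x 1 (fun y => Im (f y)) (Im l).

Lemma is_cderive_cst x l : is_cderive (fun=> l) x 0.
Proof. by split => /=; exact: is_derive_cst. Qed.

Lemma is_cderive_id x : is_cderive (fun y => y%:C) x 1.
Proof. by split => /=; [exact: is_derive_id | exact: is_derive_cst]. Qed.

Lemma is_cderiveD f g x l m : is_cderive f x l -> is_cderive g x m ->
  is_cderive (fun y => f y + g y) x (l + m).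
Proof.
move=> [f1 f2] [g1 g2]; split; rewrite !reimE.
  under [fun y => Re _]funext do rewrite ReD.
  exact: (is_deriveD f1 g1).
under [fun y => Im _]funext do rewrite ImD.
exact: (is_deriveD f2 g2).
Qed.

Lemma is_cderiveM f g x l m : is_cderive f x l -> is_cderive g x m ->
  is_cderive (fun y => f y * g y) x (f x * m + l * g x).
Proof.
move=> [f1 f2] [g1 g2]; split; rewrite !reimE.
  under [fun y => Re _]funext do rewrite ReM.
  apply: (is_derive_eq (is_deriveB (is_deriveM f1 g1) (is_deriveM f2 g2))).
  by rewrite /GRing.scale /=; ring.
under [fun y => Im _]funext do rewrite ImM.
apply: (is_derive_eq (is_deriveD (is_deriveM f1 g2) (is_deriveM f2 g1))).
by rewrite /GRing.scale /=; ring.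
Qed.

Lemma is_cderive_eq f x l m : is_cderive f x l -> l = m -> is_cderive f x m.
Proof. by move=> + <-. Qed.

Lemma is_cderive_cexp f x l : is_cderive f x l ->
  is_cderive (fun y => cexp (f y)) x (l * cexp (f x)).
Proof.
move=> [f1 f2].
have e1 := is_derive1_comp (is_derive_expR (Re (f x))) f1.
have c1 := is_derive1_comp (is_derive_cos (Im (f x))) f2.
have s1 := is_derive1_comp (is_derive_sin (Im (f x))) f2.
split; rewrite !reimE /=.
  apply: (is_derive_eq (is_deriveM e1 c1)).
  by rewrite /GRing.scale /=; ring.
apply: (is_derive_eq (is_deriveM e1 s1)).
by rewrite /GRing.scale /=; ring.
Qed.

(** Solves the linear differential equations below: the unknown, multiplied by the inverse of the
    expected solution, has derivative 0. *)
Lemma is_cderive0_cst f : (forall x, is_cderive f x 0) -> forall x y, f x = f y.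
Proof.
move=> df x y; apply: complexP.
  by apply: (@is_derive_0_is_cst _ (fun y => Re (f y))) => z; case: (df z).
by apply: (@is_derive_0_is_cst _ (fun y => Im (f y))) => z; case: (df z).
Qed.

End RealVariableDerivative.

(** * Measurability of complex-valued functions *)

Section ComplexMeasurability.
Context {R : realType} d (T : measurableType d).
Implicit Types (f g : T -> R[i]) (u v : T -> R).

Definition cmeasurable f : Prop :=
  measurable_fun setT (fun x => Re (f x)) /\
  measurable_fun setT (fun x => Im (f x)).

Lemma cmeasurable_cst c : cmeasurable (fun=> c).
Proof. by split; exact: measurable_cst. Qed.

Lemma cmeasurable_pair u v : measurable_fun setT u -> measurable_fun setT v ->
  cmeasurable (fun x => u x +i* v x).
Proof. by []. Qed.

Lemma cmeasurable_real u : measurable_fun setT u -> cmeasurable (fun x => (u x)%:C).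
Proof. by move=> mu; split => //; exact: measurable_cst. Qed.

Lemma cmeasurableD f g : cmeasurable f -> cmeasurable g ->
  cmeasurable (fun x => f x + g x).
Proof.
move=> [f1 f2] [g1 g2]; split.
  by under eq_fun do rewrite ReD; exact: measurable_funD.
by under eq_fun do rewrite ImD; exact: measurable_funD.
Qed.

Lemma cmeasurableM f g : cmeasurable f -> cmeasurable g ->
  cmeasurable (fun x => f x * g x).
Proof.
move=> [f1 f2] [g1 g2]; split.
  under eq_fun do rewrite ReM.
  by apply: measurable_funB; exact: measurable_funM.
under eq_fun do rewrite ImM.
by apply: measurable_funD; exact: measurable_funM.
Qed.

Lemma cmeasurableN f : cmeasurable f -> cmeasurable (fun x => - f x).
Proof.
move=> mf; under eq_fun do rewrite -mulN1r.
by apply: cmeasurableM => //; exact: cmeasurable_cst.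
Qed.

Lemma cmeasurableX f n : cmeasurable f -> cmeasurable (fun x => f x ^+ n).
Proof.
move=> mf; elim: n => [|n IH]; first exact: cmeasurable_cst.
by under eq_fun do rewrite exprS; exact: cmeasurableM.
Qed.

Lemma cmeasurableJ f : cmeasurable f -> cmeasurable (fun x => (f x)^*).
Proof.
move=> [f1 f2]; split; first by under eq_fun do rewrite ReJ.
by under eq_fun do rewrite ImJ; exact: measurableT_comp.
Qed.

Lemma cmeasurable_cexp f : cmeasurable f -> cmeasurable (fun x => cexp (f x)).
Proof.
move=> [f1 f2]; have me : measurable_fun setT (fun x => expR (Re (f x))).
  exact: measurableT_comp.
by split => /=; apply: measurable_funM => //; apply: measurableT_comp => //;
  apply: continuous_measurable_fun => x; [exact: continuous_cos|exact: continuous_sin].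
Qed.

Lemma measurable_normc f : cmeasurable f -> measurable_fun setT (fun x => normc (f x)).
Proof.
move=> [f1 f2]; have -> : (fun x => normc (f x)) =
    (fun x => Num.sqrt (Re (f x) ^+ 2 + Im (f x) ^+ 2)).
  by apply/funext => x; case: (f x).
apply: measurableT_comp; first by apply: continuous_measurable_fun => x; exact: sqrt_continuous.
by apply: measurable_funD; exact: measurable_funX.
Qed.

End ComplexMeasurability.

Lemma cmeasurable_comp (R : realType) d1 d2 (T1 : measurableType d1)
    (T2 : measurableType d2) (f : T2 -> R[i]) (h : T1 -> T2) :
  cmeasurable f -> measurable_fun setT h -> cmeasurable (fun x => f (h x)).
Proof.
move=> [f1 f2] mh; split.
  exact: (measurableT_comp f1 mh).
exact: (measurableT_comp f2 mh).
Qed.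

(** * Linearity and conjugation for complex integrals *)

Section ComplexIntegral.
Context {R : realType} d (T : measurableType d) (mu : {measure set T -> \bar R}).
Implicit Types (f g : T -> R[i]) (h : T -> R) (c : R[i]).

Lemma cintegrable_measurable f : cintegrable mu f -> cmeasurable f.
Proof.
move=> [/measurable_int f1 /measurable_int f2].
by split; exact/measurable_EFinP.
Qed.

Lemma cintegrable_dom f h : cmeasurable f -> mu.-integrable setT (EFin \o h) ->
  (forall x, normc (f x) <= h x) -> cintegrable mu f.
Proof.
move=> [f1 f2] ih fh; split; apply: (le_integrable _ _ _ ih) => //=.
- exact/measurable_EFinP.
- move=> x _; rewrite lee_fin (le_trans (normc_Re_le _)) //.
  by rewrite (le_trans (fh x)) // ler_norm.
- exact/measurable_EFinP.
- move=> x _; rewrite lee_fin (le_trans (normc_Im_le _)) //.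
  by rewrite (le_trans (fh x)) // ler_norm.
Qed.

Lemma cintegrable_normc f : cintegrable mu f ->
  mu.-integrable setT (fun x => (normc (f x))%:E).
Proof.
move=> cf; have mf := cintegrable_measurable cf; case: cf => f1 f2.
have f12 := integrableD measurableT (integrable_norm f1) (integrable_norm f2).
apply: (le_integrable _ _ _ f12) => //.
  by apply/measurable_EFinP; exact: measurable_normc.
move=> x _ /=; rewrite lee_fin ger0_norm ?normc_ge0 //.
by rewrite ger0_norm ?addr_ge0 // normc_le_ReIm.
Qed.

Lemma cintegral_ext f g : f =1 g -> cintegral mu f = cintegral mu g.
Proof. by move=> /funext ->. Qed.

Lemma cintegralD f g : cintegrable mu f -> cintegrable mu g ->
  cintegral mu (fun x => f x + g x) = cintegral mu f + cintegral mu g.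
Proof.
move=> [f1 f2] [g1 g2]; apply: complexP; rewrite ?reimE /=.
  by under eq_Rintegral do rewrite ReD; exact: RintegralD.
by under eq_Rintegral do rewrite ImD; exact: RintegralD.
Qed.

Lemma cintegrableD f g : cintegrable mu f -> cintegrable mu g ->
  cintegrable mu (fun x => f x + g x).
Proof.
move=> [f1 f2] [g1 g2]; split.
  by under eq_fun do rewrite ReD EFinD; exact: integrableD.
by under eq_fun do rewrite ImD EFinD; exact: integrableD.
Qed.

Lemma cintegrableZ c f : cintegrable mu f -> cintegrable mu (fun x => c * f x).
Proof.
move=> [f1 f2]; split.
  under eq_fun do rewrite ReM EFinB !EFinM.
  by apply: integrableB => //; exact: integrableZl.
under eq_fun do rewrite ImM EFinD !EFinM.
by apply: integrableD => //; exact: integrableZl.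
Qed.

Lemma cintegralZ c f : cintegrable mu f ->
  cintegral mu (fun x => c * f x) = c * cintegral mu f.
Proof.
move=> [f1 f2]; have Z k h : mu.-integrable setT (EFin \o h) ->
    mu.-integrable setT (EFin \o (fun x => k * h x)).
  by move=> ih; exact: (integrableZl measurableT k ih).
apply: complexP; rewrite ?reimE /=.
  under eq_Rintegral do rewrite ReM.
  by rewrite RintegralB ?RintegralZl //; exact: Z.
under eq_Rintegral do rewrite ImM.
by rewrite RintegralD ?RintegralZl //; exact: Z.
Qed.

Lemma cintegralJ f : cintegrable mu f ->
  cintegral mu (fun x => (f x)^*) = (cintegral mu f)^*.
Proof.
move=> [f1 f2]; apply: complexP; rewrite ?reimE /=.
  by under eq_Rintegral do rewrite ReJ.
under eq_Rintegral do rewrite ImJ -mulN1r.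
by rewrite RintegralZl // mulN1r.
Qed.

Lemma cintegrableJ f : cintegrable mu f -> cintegrable mu (fun x => (f x)^*).
Proof.
move=> [f1 f2]; split; first by under eq_fun do rewrite ReJ.
by under eq_fun do rewrite ImJ -mulN1r EFinM; exact: integrableZl.
Qed.

End ComplexIntegral.

(** * Fubini's theorem for complex integrals *)

Section ComplexFubini.
Context {R : realType} d1 d2 (T1 : measurableType d1) (T2 : measurableType d2).
Context (m1 : {sigma_finite_measure set T1 -> \bar R}).
Context (m2 : {sigma_finite_measure set T2 -> \bar R}).

Lemma integrable_prodM (g1 : T1 -> R) (g2 : T2 -> R) :
  m1.-integrable setT (EFin \o g1) -> m2.-integrable setT (EFin \o g2) ->
  (m1 \x m2)%E.-integrable setT (fun p => (g1 p.1 * g2 p.2)%:E).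
Proof.
move=> i1 i2; have m1g : measurable_fun setT g1 by move: i1 => /measurable_int /measurable_EFinP.
have m2g : measurable_fun setT g2 by move: i2 => /measurable_int /measurable_EFinP.
apply/integrable12ltyP.
  apply/measurable_EFinP; apply: measurable_funM.
    exact: (measurableT_comp m1g measurable_fst).
  exact: (measurableT_comp m2g measurable_snd).
set I2 := (\int[m2]_y `|(g2 y)%:E|)%E.
have I2fin : I2 \is a fin_num.
  rewrite ge0_fin_numE; first by case/integrableP: i2.
  by apply: integral_ge0 => y _; exact: abse_ge0.
rewrite (_ : (fun x => _) = (fun x => I2 * `|(g1 x)%:E|)%E); last first.
  apply/funext => x /=; rewrite muleC /I2.
  rewrite -ge0_integralZl //.
    by apply: eq_integral => y _; rewrite normrM EFinM.
  by apply: measurableT_comp => //; exact/measurable_EFinP.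
rewrite ge0_integralZl //.
- rewrite lte_mul_pinfty //; first by apply: integral_ge0 => y _; exact: abse_ge0.
  by case/integrableP: i1.
- by apply: measurableT_comp => //; exact/measurable_EFinP.
- by apply: integral_ge0 => y _; exact: abse_ge0.
Qed.

Context (f : T1 * T2 -> R[i]).
Hypothesis if12 : cintegrable (m1 \x m2)%E f.
Hypothesis if1 : forall x, cintegrable m2 (fun y => f (x, y)).
Hypothesis if2 : forall y, cintegrable m1 (fun x => f (x, y)).

(** [cintegral] takes [fine] of each inner integral. Since every slice is integrable, and not just
    almost every one, [fineK] removes it pointwise. *)
Lemma cintegral_prod12 :
  cintegral (m1 \x m2)%E f = cintegral m1 (fun x => cintegral m2 (fun y => f (x, y))).
Proof.
case: if12 => i1 i2; apply: complexP => /=; congr fine.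
  rewrite -(integral12_prod_meas1 i1); apply: eq_integral => x _.
  by rewrite fineK //; apply: integrable_fin_num => //; exact: (if1 x).1.
rewrite -(integral12_prod_meas1 i2); apply: eq_integral => x _.
by rewrite fineK //; apply: integrable_fin_num => //; exact: (if1 x).2.
Qed.

Lemma cintegral_prod21 :
  cintegral (m1 \x m2)%E f = cintegral m2 (fun y => cintegral m1 (fun x => f (x, y))).
Proof.
case: if12 => i1 i2; apply: complexP => /=; congr fine.
  rewrite -(integral21_prod_meas1 i1); apply: eq_integral => y _.
  by rewrite fineK //; apply: integrable_fin_num => //; exact: (if2 y).1.
rewrite -(integral21_prod_meas1 i2); apply: eq_integral => y _.
by rewrite fineK //; apply: integrable_fin_num => //; exact: (if2 y).2.
Qed.

End ComplexFubini.

(** * Gaussian majorants *)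

Section GaussianDomination.
Context {R : realType}.
Local Notation mu := (@lebesgue_measure R).
Implicit Types (f g : R[i] -> R[i]) (e c : R).

Lemma integral_gauss e : 0 < e ->
  mu.-integrable setT (fun x => (expR (- (e * x ^+ 2)))%:E) /\
  \int[mu]_x expR (- (e * x ^+ 2)) = Num.sqrt (pi / e).
Proof.
(* [s] is the standard deviation of the centred normal law of variance 1 / (2e), whose total mass 1
   gives the value. *)
move=> e0; set s := Num.sqrt ((e *+ 2)^-1).
have s2 : s ^+ 2 = (e *+ 2)^-1 by rewrite sqr_sqrtr // invr_ge0 mulrn_wge0 // ltW.
have s0 : s != 0 by rewrite gt_eqF // sqrtr_gt0 invr_gt0 pmulrn_lgt0.
have E x : expR (- (e * x ^+ 2)) = Num.sqrt (pi / e) * normal_pdf 0 s x.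
  rewrite normal_pdfE // /normal_peak /normal_fun s2 subr0.
  have -> : (e *+ 2)^-1 * pi *+ 2 = pi / e by field; lra.
  rewrite [RHS]mulrA divff ?mul1r; last first.
    by rewrite gt_eqF // sqrtr_gt0 divr_gt0 // pi_gt0.
  by congr expR; field; lra.
have in1 : mu.-integrable setT (EFin \o normal_pdf 0 s).
  exact: integrable_normal_pdf.
split; last first.
  under eq_Rintegral do rewrite E.
  by rewrite RintegralZl // /Rintegral integral_normal_pdf /= mulr1.
by under eq_fun do rewrite E EFinM; exact: (integrableZl measurableT _ in1).
Qed.

Lemma integrable_gauss_area e c : 0 < e ->
  area.-integrable setT
    (fun p => (c * expR (- (e * normc (p.1 +i* p.2) ^+ 2)))%:E).
Proof.
move=> e0; have [i1 _] := integral_gauss e0.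
have i12 := integrable_prodM i1 i1.
have E (p : R * R) : (c * expR (- (e * normc (p.1 +i* p.2) ^+ 2)))%:E =
    (c%:E * (expR (- (e * p.1 ^+ 2)) * expR (- (e * p.2 ^+ 2)))%:E)%E.
  by rewrite normc_sqr /= -EFinM -expRD; congr (_ * expR _)%:E; ring.
under eq_fun do rewrite E.
exact: (integrableZl measurableT c i12).
Qed.

(** The class of factors absorbed by any Gaussian decay. It is stable under products, because [e]
    can be split in halves, and contains polynomials and exponentials of linear functions. *)
Definition subgaussian f : Prop :=
  forall e, 0 < e -> exists2 c, 0 <= c &
    forall z, normc (f z) <= c * expR (e * normc z ^+ 2).

Lemma subgaussian_cst (k : R[i]) : subgaussian (fun=> k).
Proof.
move=> e e0; exists (normc k) => [|z]; first exact: normc_ge0.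
rewrite ler_peMr ?normc_ge0 // -expR0 ler_expR.
by rewrite mulr_ge0 ?exprn_ge0 ?normc_ge0 // ltW.
Qed.

Lemma subgaussian_id : subgaussian id.
Proof.
(* From [x <= 1 + x ^+ 2 <= (1 + e^-1) * (1 + e * x ^+ 2)] and [1 + y <= expR y]. *)
move=> e e0; exists (1 + e^-1) => [|z]; first by rewrite addr_ge0 // invr_ge0 ltW.
apply: (@le_trans _ _ ((1 + e^-1) * (1 + e * normc z ^+ 2))); last first.
  rewrite ler_pM2l ?expR_ge1Dx //.
  by rewrite addr_gt0 // invr_gt0.
have z0 := normc_ge0 z; have ei : 0 < e^-1 by rewrite invr_gt0.
have -> : (1 + e^-1) * (1 + e * normc z ^+ 2) =
  1 + e^-1 + e * normc z ^+ 2 + normc z ^+ 2 by field; lra.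
have := sqr_ge0 (normc z - 1).
have : 0 <= e * normc z ^+ 2 by rewrite mulr_ge0 ?sqr_ge0 // ltW.
nra.
Qed.

Lemma subgaussianD f g : subgaussian f -> subgaussian g ->
  subgaussian (fun z => f z + g z).
Proof.
move=> sf sg e e0; have [c c0 cf] := sf e e0; have [k k0 kg] := sg e e0.
exists (c + k) => [|z]; first by rewrite addr_ge0.
by rewrite (le_trans (ler_normcD _ _)) // mulrDl lerD.
Qed.

Lemma subgaussianM f g : subgaussian f -> subgaussian g ->
  subgaussian (fun z => f z * g z).
Proof.
move=> sf sg e e0; have e2 : 0 < e / 2 by lra.
have [c c0 cf] := sf _ e2; have [k k0 kg] := sg _ e2.
exists (c * k) => [|z]; first by rewrite mulr_ge0.
have -> : e * normc z ^+ 2 = e / 2 * normc z ^+ 2 + e / 2 * normc z ^+ 2 by field.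
rewrite expRD normcM mulrACA; apply: ler_pM => //; exact: normc_ge0.
Qed.

(** Completing the square: [c * t <= c ^+ 2 / (4 * e) + e * t ^+ 2]. *)
Lemma subgaussian_cexp f c : (forall z, normc (f z) <= c * normc z) ->
  subgaussian (fun z => cexp (f z)).
Proof.
move=> fc e e0; exists (expR (c ^+ 2 / (4 * e))) => [|z]; first exact: expR_ge0.
rewrite normc_cexp -expRD ler_expR.
have h1 := normc_Re_le (f z); have h2 := fc z.
have h3 := ler_norm (Re (f z)); set t := normc z in h2 *.
apply: (@le_trans _ _ (c * t)); first lra.
have e4 : 0 <= (4 * e)^-1 by rewrite invr_ge0; lra.
have : 0 <= (4 * e)^-1 * (c - 2 * e * t) ^+ 2 by rewrite mulr_ge0 // sqr_ge0.
have -> : (4 * e)^-1 * (c - 2 * e * t) ^+ 2 = c ^+ 2 / (4 * e) + e * t ^+ 2 - c * t.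
  by field; lra.
lra.
Qed.

(** One half of the decay rate absorbs [f]; the other half remains. *)
Lemma subgaussian_bound f (q : R[i] -> R[i]) e : 0 < e -> subgaussian f ->
  (forall z, Re (q z) <= - (e * normc z ^+ 2)) ->
  exists2 c, 0 <= c & forall z,
    normc (f z * cexp (q z)) <= c * expR (- (e / 2 * normc z ^+ 2)).
Proof.
move=> e0 sf qe; have e2 : 0 < e / 2 by lra.
have [c c0 cf] := sf _ e2; exists c => // z.
have -> : - (e / 2 * normc z ^+ 2) = e / 2 * normc z ^+ 2 - e * normc z ^+ 2 by field.
rewrite normcM normc_cexp expRD mulrA; apply: ler_pM => //.
- exact: normc_ge0.
- by rewrite ler_expR.
Qed.

Lemma cintegrable_line f (q : R[i] -> R[i]) e : 0 < e -> subgaussian f ->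
  (forall x : R, Re (q x%:C) <= - (e * x ^+ 2)) ->
  cmeasurable (fun x : measurableTypeR R => f x%:C) ->
  cmeasurable (fun x : measurableTypeR R => q x%:C) ->
  cintegrable mu (fun x => f x%:C * cexp (q x%:C)).
Proof.
move=> e0 sf qe mf mq; have e2 : 0 < e / 2 by lra.
have [c c0 cf] := sf _ e2.
have [ig _] := integral_gauss e2.
apply: (@cintegrable_dom _ _ _ mu _ (fun x => c * expR (- (e / 2 * x ^+ 2)))).
- by apply: cmeasurableM => //; exact: cmeasurable_cexp.
- exact: (integrableZl measurableT c ig).
- move=> x; have -> : - (e / 2 * x ^+ 2) = e / 2 * x ^+ 2 - e * x ^+ 2 by field.
  rewrite normcM normc_cexp expRD mulrA; apply: ler_pM => //.
  + exact: normc_ge0.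
  + by have := cf x%:C; rewrite normc_real real_normK ?num_real.
  + by rewrite ler_expR.
Qed.

End GaussianDomination.

(** * Differentiation of an integral in a real parameter of the exponent *)

Section DifferentiationUnderIntegral.
Context {R : realType}.
Local Notation mu := (@lebesgue_measure R).
Context (u v : R -> R[i]) (G : R -> R -> R).
Hypothesis iE : forall r : R, cintegrable mu (fun x => cexp (u x + r%:C * v x)).
Hypothesis G0 : forall M x, 0 <= G M x.
Hypothesis iG : forall M : R, 0 < M -> mu.-integrable setT (EFin \o G M).
Hypothesis vG : forall M r x : R, `|r| <= M ->
  normc (v x * cexp (u x + r%:C * v x)) <= G M x.

(** Differentiability is local, so a majorant [G M] for each bounded range of the parameter
    suffices; it is used on an open interval around [r]. *)
Lemma is_cderive_cintegral_cexp r :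
  is_cderive (fun r : R => cintegral mu (fun x => cexp (u x + r%:C * v x))) r
    (cintegral mu (fun x => v x * cexp (u x + r%:C * v x))).
Proof.
have dE (x k : R) : is_cderive (fun y => cexp (u x + y%:C * v x)) k
    (v x * cexp (u x + k%:C * v x)).
  apply: is_cderive_cexp; apply: is_cderive_eq.
    apply: is_cderiveD; first exact: is_cderive_cst.
    by apply: is_cderiveM; [exact: is_cderive_id|exact: is_cderive_cst].
  by rewrite mulr0 add0r add0r mul1r.
set M := `|r| + 1.
have M0 : 0 < M by rewrite /M ltr_wpDl.
have Ir : `](- M), M[%classic r.
  by rewrite /= in_itv /= -ltr_norml /M ltrDl.
have IM (k : R) : `](- M), M[%classic k -> `|k| <= M.
  by rewrite /= in_itv /= -ltr_norml => /ltW.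
(* Real and imaginary parts are treated at once: [p] stands for either, and the majorant only needs
   [p] to be bounded by the modulus. *)
suff main (p : R[i] -> R) : (forall z, `|p z| <= normc z) ->
    (forall k : R, mu.-integrable setT (EFin \o (fun x => p (cexp (u x + k%:C * v x))))) ->
    (forall x k : R, is_derive k 1 (fun y => p (cexp (u x + y%:C * v x)))
       (p (v x * cexp (u x + k%:C * v x)))) ->
    is_derive r 1 (fun r : R => \int[mu]_x p (cexp (u x + r%:C * v x)))
      (\int[mu]_x p (v x * cexp (u x + r%:C * v x))).
  split; apply: main.
  - exact: normc_Re_le.
  - by move=> k; exact: (iE k).1.
  - by move=> x k; exact: (dE x k).1.
  - exact: normc_Im_le.
  - by move=> k; exact: (iE k).2.
  - by move=> x k; exact: (dE x k).2.
move=> pn ip dp.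
have pE (x k : R) : partial1of2 (fun k x : R => p (cexp (u x + k%:C * v x))) k x =
    p (v x * cexp (u x + k%:C * v x)).
  by rewrite partial1of2E; have [_ ->] := dp x k.
have h1 (k x : R) : `](- M), M[%classic k -> (@setT R) x ->
    derivable (fun k : R => p (cexp (u x + k%:C * v x))) k 1.
  by move=> _ _; have [] := dp x k.
have h2 (k x : R) : `](- M), M[%classic k -> (@setT R) x ->
    `|partial1of2 (fun k x : R => p (cexp (u x + k%:C * v x))) k x| <= G M x.
  move=> kM _; rewrite pE (le_trans (pn _)) //; apply: vG; exact: IM.
have d := derivable_under_integral measurableT Ir (fun k _ => ip k) h1 (G0 M) (iG M0) h2.
apply: DeriveDef; first exact: d.
rewrite -derive1E (differentiation_under_integral measurableT Ir (fun k _ => ip k) h1 (G0 M) (iG M0) h2).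
by apply: eq_Rintegral => x _; rewrite pE.
Qed.

End DifferentiationUnderIntegral.

(** * Integrals over the line of derivatives of decaying functions *)

Section VanishingAtInfinity.
Context {R : realType}.
Local Notation mu := (@lebesgue_measure R).

(** The fundamental theorem of calculus on growing intervals, with dominated convergence by [|f|].
    The decay of [F] makes the boundary terms O(1 / n), so [harmonic] squeezes them to 0. *)
Lemma Rintegral_derive_eq0 (F f : R -> R) (c : R) :
  (forall x : R, is_derive x 1 F (f x)) -> continuous f ->
  mu.-integrable setT (EFin \o f) ->
  (forall x, (`|x| + 1) * `|F x| <= c) -> \int[mu]_x f x = 0.
Proof.
move=> dF cf intf Fc.
have cF : continuous F.
  move=> x; have [dFx _] := dF x.
  by move/derivable1_diffP/differentiable_continuous: dFx.
pose I n : set R := `[- n.+1%:R, n.+1%:R]%classic.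
pose f_ n := (EFin \o f) \_ (I n).
have mf : measurable_fun setT (EFin \o f) by apply/measurable_EFinP; apply: continuous_measurable_fun.
have f_cvg x : f_ n x @[n --> \oo] --> (f x)%:E.
  apply: cvg_near_cst; exists (Num.Def.trunc `|x|) => // n /= xn.
  rewrite /f_ /patch mem_set //= /I /= in_itv /= -ler_norml.
  apply: ltW; apply: (lt_le_trans (truncnS_gt _)).
  by rewrite ler_nat ltnS.
have mf_ n : measurable_fun setT (f_ n).
  apply/(measurable_restrictT _ _).1; first exact: measurable_itv.
  exact: measurable_funTS.
have [|||_ _ lim1] := @dominated_convergence _ _ _ mu setT measurableT f_
  (EFin \o f) (fun x => `|(f x)%:E|%E) mf_ mf.
- by apply: aeW => x _; exact: f_cvg.
- exact: integrable_abse.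
- apply: aeW => x n _; rewrite /f_ /patch; case: ifP => //= _.
  by rewrite normr0 lee_fin.
have intE n : (\int[mu]_x f_ n x)%E = (F n.+1%:R - F (- n.+1%:R))%:E.
  transitivity (\int[mu]_(x in I n) (f x)%:E)%E; first by rewrite [RHS]integral_mkcond.
  rewrite EFinB /I.
  apply: continuous_FTC2.
  - by rewrite gtrN.
  - exact: continuous_subspaceT.
  - split.
    + by move=> x _; have [] := dF x.
    + by apply: cvg_at_right_filter; exact: cF.
    + by apply: cvg_at_left_filter; exact: cF.
  - by move=> x _; rewrite derive1E; have [_ ->] := dF x.
have Fn n : `|F n.+1%:R - F (- n.+1%:R)| <= 2 * c * harmonic n.
  have n0 : 0 < n.+1%:R :> R by [].
  have h1 := Fc n.+1%:R; have h2 := Fc (- n.+1%:R); rewrite normrN in h2.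
  rewrite ger0_norm ?ler0n // in h1 h2.
  rewrite /harmonic ler_pdivlMr //.
  have h3 := ler_normB (F n.+1%:R) (F (- n.+1%:R)).
  have n1 := normr_ge0 (F n.+1%:R); have n2 := normr_ge0 (F (- n.+1%:R)).
  nra.
have lim2 : (\int[mu]_x f_ n x)%E @[n --> \oo] --> 0%E.
  rewrite (_ : (fun n => _) = (fun n => (F n.+1%:R - F (- n.+1%:R))%:E)); last first.
    by apply/funext => n; rewrite intE.
  apply: cvg_EFin; first exact: nearW.
  apply: norm_cvg0; apply: (@squeeze_cvgr _ _ _ _ (cst 0) (fun n => 2 * c * harmonic n)).
  - by apply: nearW => n /=; rewrite normr_ge0 Fn.
  - exact: cvg_cst.
  - rewrite -[X in _ --> X](mulr0 (2 * c)).
    by apply: cvgM; [exact: cvg_cst|exact: cvg_harmonic].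
by rewrite /Rintegral (cvg_unique _ lim1 lim2).
Qed.

Lemma cintegral_derive_eq0 (F f : R -> R[i]) (c : R) :
  (forall x, is_cderive F x (f x)) -> (forall x, exists l, is_cderive f x l) ->
  cintegrable mu f ->
  (forall x, (`|x| + 1) * normc (F x) <= c) -> cintegral mu f = 0.
Proof.
move=> dF df [f1 f2] Fc.
have cont g : (forall x : R, exists l : R, is_derive x 1 g l) -> continuous (g : R -> R).
  move=> dg x; have [l [dgx _]] := dg x.
  by move/derivable1_diffP/differentiable_continuous: dgx.
apply: complexP => /=.
  apply: (@Rintegral_derive_eq0 (fun x => Re (F x)) _ c) => //.
  - by move=> x; have [] := dF x.
  - by apply: cont => x; have [l [? _]] := df x; exists (Re l).
  - by move=> x; rewrite (le_trans _ (Fc x)) // ler_wpM2l ?normc_Re_le.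
apply: (@Rintegral_derive_eq0 (fun x => Im (F x)) _ c) => //.
- by move=> x; have [] := dF x.
- by apply: cont => x; have [l [_ ?]] := df x; exists (Im l).
- by move=> x; rewrite (le_trans _ (Fc x)) // ler_wpM2l ?normc_Im_le.
Qed.

End VanishingAtInfinity.

(* [\sum_n hp k x n u^n / n! = exp (u x + k u^2 / 2)], so that the classical
   Hermite polynomial is [H_n(x) = hp (-2) (2 x) n]. *)
Fixpoint hp (K : comNzRingType) (k x : K) (n : nat) : K :=
  match n with
  | 0 => 1
  | n'.+1 => match n' with
             | 0 => x
             | n''.+1 => x * hp k x n' + n'%:R * k * hp k x n''
             end
  end.

(** * Algebra, growth and derivatives of Hermite-type polynomials *)

Section HermitePolynomials.

Lemma hpSS (K : comNzRingType) (k x : K) n :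
  hp k x n.+2 = x * hp k x n.+1 + n.+1%:R * k * hp k x n.
Proof. by []. Qed.

(* The recurrence makes sense at [n = 0] too, where the junk value [n.-1] is
   multiplied by 0. *)
Lemma hpS (K : comNzRingType) (k x : K) n :
  hp k x n.+1 = x * hp k x n + n%:R * k * hp k x n.-1.
Proof. by case: n => //=; rewrite mulr1 mul0r mul0r addr0. Qed.

Lemma hp_ind2 (P : nat -> Prop) : P 0 -> P 1 ->
  (forall n, P n -> P n.+1 -> P n.+2) -> forall n, P n.
Proof.
move=> P0 P1 IH n; suff [] : P n /\ P n.+1 by [].
by elim: n => // n [Pn Pn1]; split => //; exact: IH.
Qed.

(** Replaces [u] by [c * u] in the generating function. The n-th powers in the eigenvalue come from
    here. *)
Lemma hp_scale (K : comNzRingType) (k x c : K) n :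
  hp (c ^+ 2 * k) (c * x) n = c ^+ n * hp k x n.
Proof.
elim/hp_ind2: n => [||n H0 H1]; rewrite ?mulr1 //.
by rewrite !hpSS H0 H1 !exprS; ring.
Qed.

(** Used to pass from [R] to [R[i]] along the embedding, and from [{poly R[i]}] to [R[i]] by
    evaluation. *)
Lemma hp_rmorph (K L : comNzRingType) (phi : {rmorphism K -> L}) k x n :
  phi (hp k x n) = hp (phi k) (phi x) n.
Proof.
elim/hp_ind2: n => [||n H0 H1] //; first exact: rmorph1.
by rewrite !hpSS -H0 -H1 rmorphD !rmorphM rmorph_nat.
Qed.

Lemma size_hp (K : idomainType) (k : K) n : size (hp k%:P 'X n) = n.+1.
Proof.
elim/hp_ind2: n => [||n H0 H1]; [exact: size_poly1|exact: size_polyX|].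
have nz : hp k%:P 'X n.+1 != 0 by rewrite -size_poly_eq0 H1.
have sX : size ('X * hp k%:P 'X n.+1) = n.+3.
  by rewrite size_mul ?polyX_eq0 // size_polyX H1.
rewrite hpSS size_polyDl sX //.
have -> : n.+1%:R * k%:P = (n.+1%:R * k)%:P by rewrite polyCM rmorph_nat.
by rewrite mul_polyC ltnS (leq_trans (size_scale_leq _ _)) // H0.
Qed.

Context {R : realType}.
Implicit Types (k z al eta : R[i]).

Lemma subgaussian_hp k al eta n : subgaussian (fun z => hp k (al * z + eta) n).
Proof.
have lin : subgaussian (fun z => al * z + eta).
  apply: subgaussianD; last exact: subgaussian_cst.
  by apply: subgaussianM; [exact: subgaussian_cst|exact: subgaussian_id].
elim/hp_ind2: n => [||n H0 H1] //; first exact: subgaussian_cst.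
apply: subgaussianD; first exact: subgaussianM.
by apply: subgaussianM => //; exact: subgaussian_cst.
Qed.

Lemma cmeasurable_hp d (T : measurableType d) (u : T -> R[i]) k n :
  cmeasurable u -> cmeasurable (fun x => hp k (u x) n).
Proof.
move=> mu; elim/hp_ind2: n => [||n H0 H1]; [exact: cmeasurable_cst|by []|].
apply: cmeasurableD; first exact: cmeasurableM.
by apply: cmeasurableM => //; exact: cmeasurable_cst.
Qed.

(** The Appell property: differentiating the generating function in its argument multiplies it by
    [u]. *)
Lemma is_cderive_hp k al eta n x :
  is_cderive (fun y : R => hp k (al * y%:C + eta) n) x
    (n%:R * al * hp k (al * x%:C + eta) n.-1).
Proof.
have lin : is_cderive (fun y : R => al * y%:C + eta) x al.
  apply: is_cderive_eq.
    apply: is_cderiveD; last exact: is_cderive_cst.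
    by apply: is_cderiveM; [exact: is_cderive_cst|exact: is_cderive_id].
  by rewrite mul0r !addr0 mulr1.
elim/hp_ind2: n => [||n H0 H1]; first by rewrite !mul0r; exact: is_cderive_cst.
  by rewrite mul1r mulr1.
apply: is_cderive_eq.
  apply: is_cderiveD.
    exact: (is_cderiveM lin H1).
  exact: (is_cderiveM (is_cderive_cst _ _) H0).
rewrite /= -/(hp _ _ n.+1) hpS; move: (hp _ _ n) (hp _ _ n.-1) => u v.
have -> : n.+2%:R = n.+1%:R + 1 :> R[i] by rewrite -natr1.
by ring.
Qed.

End HermitePolynomials.

(** * Integrals of Hermite polynomials against complex Gaussians on the line *)

Section ComplexGaussianLine.
Context {R : realType}.
Local Notation mu := (@lebesgue_measure R).
Implicit Types (A B k al eta : R[i]) (g : R[i] -> R[i]).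

Definition cgauss A B (x : R) : R[i] := cexp (- (A * x%:C ^+ 2) + B * x%:C).

Lemma cgaussE A B x : cgauss A B x = cexp (B * x%:C) * cexp (- (A * x%:C ^+ 2)).
Proof. by rewrite /cgauss cexpD mulrC. Qed.

Lemma Re_quad A (x : R) : Re (- (A * x%:C ^+ 2)) = - (Re A * x ^+ 2).
Proof. by rewrite expr2 !reimE /=; ring. Qed.

Lemma subgaussian_cgauss g B : subgaussian g -> subgaussian (fun z => g z * cexp (B * z)).
Proof.
move=> sg; apply: subgaussianM => //.
by apply: (@subgaussian_cexp _ _ (normc B)) => z; rewrite normcM.
Qed.

Lemma cmeasurable_ofreal : cmeasurable (fun x : measurableTypeR R => x%:C).
Proof. by apply: cmeasurable_real; exact: measurable_id. Qed.

Lemma cintegrable_cgauss g A B : 0 < Re A -> subgaussian g ->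
  cmeasurable (fun x : measurableTypeR R => g x%:C) ->
  cintegrable mu (fun x => g x%:C * cgauss A B x).
Proof.
move=> A0 sg mg.
have := @cintegrable_line _ _ (fun z => - (A * z ^+ 2)) _ A0 (subgaussian_cgauss B sg).
have -> : (fun x => g x%:C * cgauss A B x) =
   (fun x => g x%:C * cexp (B * x%:C) * cexp (- (A * x%:C ^+ 2))).
  by apply/funext => x; rewrite cgaussE mulrA.
apply.
- by move=> x; rewrite Re_quad.
- apply: cmeasurableM => //; apply: cmeasurable_cexp; apply: cmeasurableM.
    exact: cmeasurable_cst.
  exact: cmeasurable_ofreal.
- apply: cmeasurableN; apply: cmeasurableM; first exact: cmeasurable_cst.
  by apply: cmeasurableX; exact: cmeasurable_ofreal.
Qed.

Lemma cgauss_bound g A B : 0 < Re A -> subgaussian g ->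
  exists c, forall x : R, normc (g x%:C * cgauss A B x) <= c.
Proof.
move=> A0 sg; have [c c0 cf] := subgaussian_cgauss B sg A0.
exists c => x; rewrite cgaussE mulrA normcM normc_cexp Re_quad.
apply: (@le_trans _ _ (c * expR (Re A * x ^+ 2) * expR (- (Re A * x ^+ 2)))).
  apply: ler_wpM2r; first exact: expR_ge0.
  by have := cf x%:C; rewrite normc_real real_normK ?num_real.
by rewrite -mulrA -expRD subrr expR0 mulr1.
Qed.

Lemma is_cderive_cgauss A B x :
  is_cderive (cgauss A B) x ((B - 2 * A * x%:C) * cgauss A B x).
Proof.
apply: (@is_cderive_cexp _ (fun y => - (A * y%:C ^+ 2) + B * y%:C)).
apply: is_cderive_eq.
  apply: is_cderiveD.
    under [fun y => _]funext do rewrite -mulNr expr2.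
    apply: is_cderiveM; first exact: is_cderive_cst.
    by apply: is_cderiveM; exact: is_cderive_id.
  by apply: is_cderiveM; [exact: is_cderive_cst|exact: is_cderive_id].
by move=> /=; ring.
Qed.

Lemma cintegrable_hp_cgauss g A B k al eta n : 0 < Re A -> subgaussian g ->
  cmeasurable (fun x : measurableTypeR R => g x%:C) ->
  cintegrable mu (fun x => g x%:C * hp k (al * x%:C + eta) n * cgauss A B x).
Proof.
move=> A0 sg mg.
apply: (@cintegrable_cgauss (fun z => g z * hp k (al * z + eta) n)) => //.
  by apply: subgaussianM => //; exact: subgaussian_hp.
apply: cmeasurableM => //; apply: cmeasurable_hp; apply: cmeasurableD.
  by apply: cmeasurableM; [exact: cmeasurable_cst|exact: cmeasurable_ofreal].
exact: cmeasurable_cst.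
Qed.

(** The derivative of [hp * cgauss] integrates to 0; expanding it by the Appell property and by
    [is_cderive_cgauss] gives the three terms. *)
Lemma cgauss_by_parts A B k al eta n : 0 < Re A ->
  2 * A * cintegral mu (fun x => x%:C * hp k (al * x%:C + eta) n * cgauss A B x) =
  n%:R * al * cintegral mu (fun x => 1 * hp k (al * x%:C + eta) n.-1 * cgauss A B x)
  + B * cintegral mu (fun x => 1 * hp k (al * x%:C + eta) n * cgauss A B x).
Proof.
move=> A0; have i1 m : cintegrable mu (fun x => 1 * hp k (al * x%:C + eta) m * cgauss A B x)
  := @cintegrable_hp_cgauss (fun=> 1) A B k al eta m A0
  (subgaussian_cst _) (cmeasurable_cst _ _).
have ix : cintegrable mu (fun x => x%:C * hp k (al * x%:C + eta) n * cgauss A B x)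
  := @cintegrable_hp_cgauss id A B k al eta n A0
  subgaussian_id cmeasurable_ofreal.
pose h (x : R) := hp k (al * x%:C + eta) n.
pose f (x : R) := n%:R * al * (1 * hp k (al * x%:C + eta) n.-1 * cgauss A B x) +
  (B * (1 * h x * cgauss A B x) + - (2 * A) * (x%:C * h x * cgauss A B x)).
have df x : is_cderive (fun x => h x * cgauss A B x) x (f x).
  apply: is_cderive_eq.
    by apply: is_cderiveM; [exact: is_cderive_hp|exact: is_cderive_cgauss].
  by rewrite /f /h /=; ring.
have sh := @subgaussian_hp R k al eta n.
(* Bounds without and with an extra factor [x]; their sum gives the decay at rate [|x| + 1] required
   at infinity. *)
have [c1 b1] := @cgauss_bound _ A B A0 sh.
have [c2 b2] := @cgauss_bound _ A B A0 (subgaussianM subgaussian_id sh).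
have z : cintegral mu f = 0.
  apply: (@cintegral_derive_eq0 _ _ f (c1 + c2) df).
  - move=> x; eexists; apply: is_cderiveD; last apply: is_cderiveD.
    + apply: is_cderiveM; first exact: is_cderive_cst.
      apply: is_cderiveM; last exact: is_cderive_cgauss.
      by apply: is_cderiveM; [exact: is_cderive_cst|exact: is_cderive_hp].
    + apply: is_cderiveM; first exact: is_cderive_cst.
      apply: is_cderiveM; last exact: is_cderive_cgauss.
      by apply: is_cderiveM; [exact: is_cderive_cst|exact: is_cderive_hp].
    + apply: is_cderiveM; first exact: is_cderive_cst.
      apply: is_cderiveM; last exact: is_cderive_cgauss.
      by apply: is_cderiveM; [exact: is_cderive_id|exact: is_cderive_hp].
  - exact: (cintegrableD (cintegrableZ _ (i1 n.-1))
      (cintegrableD (cintegrableZ _ (i1 n)) (cintegrableZ _ ix))).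
  - move=> x; rewrite mulrDl mul1r addrC lerD ?b1 //.
    by rewrite -normc_real -normcM mulrA b2.
move: z; rewrite /f cintegralD; last 2 first.
- exact: (cintegrableZ _ (i1 n.-1)).
- exact: (cintegrableD (cintegrableZ _ (i1 n)) (cintegrableZ _ ix)).
rewrite cintegralD; [|exact: (cintegrableZ _ (i1 n))|exact: (cintegrableZ _ ix)].
rewrite (cintegralZ _ (i1 n.-1)) (cintegralZ _ (i1 n)) (cintegralZ _ ix) addrA mulNr => /eqP; rewrite subr_eq0 => /eqP <-.
by [].
Qed.

Lemma cintegral_hp_cgauss A B k al eta n : 0 < Re A ->
  cintegral mu (fun x => hp k (al * x%:C + eta) n * cgauss A B x) =
  cintegral mu (cgauss A B) * hp (k + al ^+ 2 / (2 * A)) (eta + al * B / (2 * A)) n.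
Proof.
move=> A0; have A2 : A != 0 by apply: contraTneq A0 => ->; rewrite ltxx.
have i1 m : cintegrable mu (fun x => 1 * hp k (al * x%:C + eta) m * cgauss A B x)
  := @cintegrable_hp_cgauss (fun=> 1) A B k al eta m A0
  (subgaussian_cst _) (cmeasurable_cst _ _).
have ix m : cintegrable mu (fun x => x%:C * hp k (al * x%:C + eta) m * cgauss A B x)
  := @cintegrable_hp_cgauss id A B k al eta m A0
  subgaussian_id cmeasurable_ofreal.
pose J m := cintegral mu (fun x => 1 * hp k (al * x%:C + eta) m * cgauss A B x).
have -> : cintegral mu (cgauss A B) = J 0.
  by apply: cintegral_ext => x; rewrite /= mul1r mul1r.
have -> : cintegral mu (fun x => hp k (al * x%:C + eta) n * cgauss A B x) = J n.
  by apply: cintegral_ext => x; rewrite mul1r.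
(* The recurrence [hpS] under the integral produces a first moment [X]. Integration by parts
   eliminates it, and the two terms obtained shift [eta] and [k]. *)
have JS m : J m.+1 = (eta + al * B / (2 * A)) * J m +
    m%:R * (k + al ^+ 2 / (2 * A)) * J m.-1.
  have := @cgauss_by_parts A B k al eta m A0; rewrite -!/(J _).
  set X := cintegral mu _ => XE.
  have -> : J m.+1 = al * X + (eta * J m + m%:R * k * J m.-1).
    have Z2 := cintegrableZ (m%:R * k) (i1 m.-1); have Z1 := cintegrableZ eta (i1 m).
    rewrite -(cintegralZ _ (ix m)) -(cintegralZ _ (i1 m)) -(cintegralZ _ (i1 m.-1)).
    rewrite -(cintegralD Z1 Z2) -(cintegralD (cintegrableZ al (ix m)) (cintegrableD Z1 Z2)).
    by apply: cintegral_ext => x; rewrite hpS; ring.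
  have -> : X = (2 * A * X) / (2 * A) by field.
  by rewrite XE; field.
elim/hp_ind2: n => [||n H0 H1]; first by rewrite mulr1.
  by rewrite JS /= mul0r mul0r addr0 mulrC.
by rewrite JS H0 H1 hpSS; ring.
Qed.

Lemma cintegral_cgaussB A B : 0 < Re A ->
  cintegral mu (cgauss A B) = cintegral mu (cgauss A 0) * cexp (B ^+ 2 / (4 * A)).
Proof.
move=> A0; have A2 : A != 0 by apply: contraTneq A0 => ->; rewrite ltxx.
(* Scaling [B] by a real [r] replaces the shift of contour by the equation
   [j' = r * B ^+ 2 / (2 * A) * j] in a real variable. *)
pose j (r : R) := cintegral mu (cgauss A (r%:C * B)).
have jE r : j r = cintegral mu (fun x : R => cexp (- (A * x%:C ^+ 2) + r%:C * (B * x%:C))).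
  by apply: cintegral_ext => x; rewrite /cgauss mulrA.
have i1 B' : cintegrable mu (cgauss A B').
  have := @cintegrable_cgauss (fun=> 1) A B' A0 (subgaussian_cst _) (cmeasurable_cst _ _).
  by under [fun x => _ * _]funext do rewrite mul1r.
have A4 : 0 < Re A / 2 by rewrite divr_gt0.
have dj r : is_cderive j r (r%:C * B ^+ 2 / (2 * A) * j r).
  have -> : j = (fun r : R => cintegral mu (fun x : R =>
      cexp (- (A * x%:C ^+ 2) + r%:C * (B * x%:C)))) by apply/funext.
  set G := fun (M x : R) => normc (B * x%:C) * expR (- (Re A * x ^+ 2) + M * normc (B * x%:C)).
  apply: is_cderive_eq.
    apply: (@is_cderive_cintegral_cexp _ _ _ G).
    - move=> r'; have := i1 (r'%:C * B).
      by rewrite /cgauss; under [fun x => cexp _]funext do rewrite -mulrA.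
    - by move=> M x; rewrite mulr_ge0 ?normc_ge0 ?expR_ge0.
    - move=> M M0.
      have -> : EFin \o G M = (fun x : R => (normc (B * x%:C *
          cexp (M * normc (B * x%:C))%:C * cgauss (Re A)%:C 0 x))%:E).
        apply/funext => x; rewrite /G /= cexp_real /cgauss mul0r addr0.
        rewrite -rmorphXn -rmorphM -rmorphN cexp_real expRD !normcM.
        by rewrite !normc_real !(ger0_norm (expR_ge0 _)); congr EFin; ring.
      apply: cintegrable_normc.
      apply: (@cintegrable_cgauss (fun z => B * z * cexp (M * normc (B * z))%:C)) => //.
      + apply: subgaussianM.
          by apply: subgaussianM; [exact: subgaussian_cst|exact: subgaussian_id].
        apply: (@subgaussian_cexp _ _ (M * normc B)) => z.
        rewrite normc_real ger0_norm ?normcM ?mulrA //.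
        by rewrite !mulr_ge0 ?normc_ge0 // ltW.
      + have mB : cmeasurable (fun x : measurableTypeR R => B * x%:C).
          by apply: cmeasurableM; [exact: cmeasurable_cst|exact: cmeasurable_ofreal].
        apply: cmeasurableM => //; apply: cmeasurable_cexp.
        apply: cmeasurable_real; apply: measurable_funM; first exact: measurable_cst.
        exact: measurable_normc.
    - move=> M r' x rM; rewrite normcM ler_wpM2l ?normc_ge0 // normc_cexp ler_expR.
      rewrite ReD Re_quad lerD2l (le_trans (ler_norm _)) //.
      rewrite (le_trans (normc_Re_le _)) // normcM normc_real.
      by rewrite ler_wpM2r ?normc_ge0.
  (* With [n = 0] this is the first moment in terms of [j r]. *)
  have := @cgauss_by_parts A (r%:C * B) 0 0 0 0 A0.
  rewrite mul0r mul0r add0r /= => h.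
  transitivity (B * cintegral mu (fun x : R => x%:C * 1 * cgauss A (r%:C * B) x)).
    have ix : cintegrable mu (fun x : R => x%:C * 1 * cgauss A (r%:C * B) x).
      under [fun x => _]funext do rewrite mulr1.
      exact: (cintegrable_cgauss _ A0 subgaussian_id cmeasurable_ofreal).
    rewrite -(cintegralZ _ ix); apply: cintegral_ext => x.
    by rewrite /cgauss mulr1 !mulrA.
  have -> : cintegral mu (fun x : R => x%:C * 1 * cgauss A (r%:C * B) x) =
    (2 * A * cintegral mu (fun x : R => x%:C * 1 * cgauss A (r%:C * B) x)) / (2 * A).
    by field.
  rewrite h -jE; have -> : cintegral mu (fun x => 1 * 1 * cgauss A (r%:C * B) x) = j r.
    by apply: cintegral_ext => x; rewrite mul1r mul1r.
  by field.
pose m (r : R) := j r * cexp (- (r%:C * r%:C * (B ^+ 2 / (4 * A)))).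
have dm r : is_cderive m r 0.
  apply: is_cderive_eq.
    apply: is_cderiveM; first exact: dj.
    apply: is_cderive_cexp.
    under [fun y => _]funext do rewrite -mulrN.
    apply: is_cderiveM; last exact: is_cderive_cst.
    by apply: is_cderiveM; exact: is_cderive_id.
  by move=> /=; field.
have := is_cderive0_cst dm 1 0.
rewrite /m /j rmorph1 rmorph0 !mul0r !mul1r oppr0 cexp0 mulr1 => <-.
by rewrite -mulrA -cexpD addNr cexp0 mulr1.
Qed.

End ComplexGaussianLine.

(** * Products of two complex Gaussian constants *)

Section GaussianConstant.
Context {R : realType}.
Local Notation mu := (@lebesgue_measure R).
Implicit Types (A : R[i]) (a b c : R).

Lemma cintegral_cgauss_real a : 0 < a ->
  cintegral mu (cgauss a%:C 0) = (Num.sqrt (pi / a))%:C.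
Proof.
move=> a0; have -> : cgauss a%:C 0 = fun x => (expR (- (a * x ^+ 2)))%:C.
  apply/funext => x.
  by rewrite /cgauss mul0r addr0 -rmorphXn -rmorphM -rmorphN cexp_real.
have [_ <-] := integral_gauss a0.
apply: complexP => //=.
by rewrite Rintegral_cst //= mul0r.
Qed.

Lemma is_cderive_cgauss_parameter a b r : 0 < a ->
  is_cderive (fun r : R => cintegral mu (cgauss (a +i* (r * b)) 0)) r
    (- (0 +i* b) / (2 * (a +i* (r * b))) * cintegral mu (cgauss (a +i* (r * b)) 0)).
Proof.
move=> a0; pose A (r : R) := a +i* (r * b).
have ReA r' : 0 < Re (A r') by [].
have AE (r' : R) : A r' = a%:C + r'%:C * (0 +i* b).
  by apply: complexP; rewrite !reimE /=; ring.
have gE (r' x : R) : cgauss (A r') 0 x =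
    cexp (- (a%:C * x%:C ^+ 2) + r'%:C * (- (0 +i* b) * x%:C ^+ 2)).
  by rewrite /cgauss AE; congr cexp; ring.
have -> : (fun r : R => cintegral mu (cgauss (a +i* (r * b)) 0)) = (fun r : R =>
    cintegral mu (fun x : R => cexp (- (a%:C * x%:C ^+ 2) +
      r%:C * (- (0 +i* b) * x%:C ^+ 2)))).
  by apply/funext => r'; apply: cintegral_ext => x; exact: gE.
have sq : subgaussian (fun z : R[i] => - (0 +i* b) * (z * z)).
  apply: subgaussianM; first exact: subgaussian_cst.
  by apply: subgaussianM; exact: subgaussian_id.
have msq : cmeasurable (fun x : measurableTypeR R => - (0 +i* b) * (x%:C * x%:C)).
  apply: cmeasurableM; first exact: cmeasurable_cst.
  by apply: cmeasurableM; exact: cmeasurable_ofreal.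
have ReE (r' x : R) : Re (- (a%:C * x%:C ^+ 2) + r'%:C * (- (0 +i* b) * x%:C ^+ 2)) =
    Re (- (a%:C * x%:C ^+ 2)) by rewrite expr2 !reimE /=; ring.
apply: is_cderive_eq.
  (* The imaginary part of the parameter does not affect the modulus of the Gaussian, so one
     majorant serves all values of [M] and [r]. *)
  apply: (@is_cderive_cintegral_cexp _ _ _ (fun _ (x : R) =>
    normc (- (0 +i* b) * (x%:C * x%:C) * cgauss a%:C 0 x))).
  - move=> r'; rewrite (_ : (fun x : R => _) = cgauss (A r') 0); last first.
      by apply/funext => x; rewrite gE.
    have := @cintegrable_cgauss _ (fun=> 1) (A r') 0 (ReA r')
      (subgaussian_cst _) (cmeasurable_cst _ _).
    by under [fun x => _ * _]funext do rewrite mul1r.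
  - by move=> *; exact: normc_ge0.
  - move=> M M0; apply: cintegrable_normc.
    exact: (@cintegrable_cgauss _ (fun z => - (0 +i* b) * (z * z))).
  - move=> M r' x _; rewrite [leLHS]normcM [leRHS]normcM -expr2 ler_wpM2l ?normc_ge0 //.
    by rewrite !normc_cexp ReE mul0r addr0.
have A0 : A r != 0 by apply: contraTneq (ReA r) => ->; rewrite ltxx.
have i2 : cintegrable mu (fun x : R => x%:C * x%:C * cgauss (A r) 0 x).
  apply: (@cintegrable_cgauss _ (fun z => z * z)) => //.
    by apply: subgaussianM; exact: subgaussian_id.
  by apply: cmeasurableM; exact: cmeasurable_ofreal.
(* The second moment, by parts with [n = 1], since [hp 0 x 1] is [x]. *)
have h : 2 * A r * cintegral mu (fun x : R => x%:C * x%:C * cgauss (A r) 0 x) =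
    cintegral mu (cgauss (A r) 0).
  have e1 : cintegral mu (fun x : R => 1 * hp 0 (1 * x%:C + 0) 0 * cgauss (A r) 0 x) =
      cintegral mu (cgauss (A r) 0).
    by apply: cintegral_ext => x; rewrite /= !mul1r.
  have e2 : cintegral mu (fun x : R => x%:C * hp 0 (1 * x%:C + 0) 1 * cgauss (A r) 0 x) =
      cintegral mu (fun x : R => x%:C * x%:C * cgauss (A r) 0 x).
    by apply: cintegral_ext => x; rewrite /= mul1r addr0.
  rewrite -e1 -e2; have := @cgauss_by_parts _ (A r) 0 0 1 0 1 (ReA r).
  by rewrite mul0r addr0 mulr1 mul1r.
have -> : cintegral mu (cgauss (a +i* (r * b)) 0) = cintegral mu (cgauss (A r) 0) by [].
rewrite -h.
transitivity (- (0 +i* b) * cintegral mu (fun x : R => x%:C * x%:C * cgauss (A r) 0 x)).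
  rewrite -(cintegralZ _ i2); apply: cintegral_ext => x.
  by rewrite -gE; ring.
rewrite -/(A r); by field.
Qed.

(** Moving the parameter vertically from [Re A] to [A], each integral contributes the logarithmic
    derivative -A' / (2A). The two together cancel that of the factor [A], so the product keeps its
    value on the real axis and no root of [A] is chosen. *)
Lemma cintegral_cgauss_scaled A c : 0 < Re A -> 0 < c ->
  cintegral mu (cgauss (c%:C * A) 0) * cintegral mu (cgauss A 0) * A =
  (pi / Num.sqrt c)%:C.
Proof.
case: A => a b /= a0 c0.
pose n (r : R) := cintegral mu (cgauss ((c * a) +i* (r * (c * b))) 0) *
  cintegral mu (cgauss (a +i* (r * b)) 0) * (a%:C + r%:C * (0 +i* b)).
have ca0 : 0 < c * a by rewrite mulr_gt0.
have dn r : is_cderive n r 0.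
  have A0 : a +i* (r * b) != 0 by rewrite eq_complex /= gt_eqF.
  have AE : a%:C + r%:C * (0 +i* b) = a +i* (r * b).
    by apply: complexP; rewrite !reimE /=; ring.
  have cAE : (c * a) +i* (r * (c * b)) = c%:C * (a +i* (r * b)).
    by apply: complexP; rewrite !reimE /=; ring.
  have cbE : 0 +i* (c * b) = c%:C * (0 +i* b).
    by apply: complexP; rewrite !reimE /=; ring.
  have cC0 : c%:C != 0 by rewrite eq_complex /= gt_eqF.
  apply: is_cderive_eq.
    apply: is_cderiveM.
      by apply: is_cderiveM; apply: is_cderive_cgauss_parameter.
    apply: is_cderiveD; first exact: is_cderive_cst.
    by apply: is_cderiveM; [exact: is_cderive_id|exact: is_cderive_cst].
  rewrite /= AE cAE cbE; move: (a +i* (r * b)) A0 => A A0.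
  by field; rewrite A0 cC0.
have := is_cderive0_cst dn 1 0.
have -> : n 0 = (pi / Num.sqrt c)%:C.
  rewrite /n !mul0r ?rmorph0 ?mul0r addr0.
  rewrite (cintegral_cgauss_real ca0) (cintegral_cgauss_real a0) -!rmorphM.
  congr (_)%:C; have pia : 0 <= pi / a :> R by rewrite divr_ge0 ?pi_ge0 // ltW.
  have -> : pi / (c * a) = c^-1 * (pi / a) by field; rewrite !gt_eqF.
  rewrite sqrtrM ?invr_ge0 ?ltW // -(mulrA (Num.sqrt c^-1)) -expr2 sqr_sqrtr //.
  have sc0 : Num.sqrt c != 0 by rewrite gt_eqF // sqrtr_gt0.
  have an0 : a != 0 by rewrite gt_eqF.
  by rewrite sqrtrV ?ltW //; field; rewrite sc0 an0.
move=> <-; rewrite /n !mul1r ?rmorph1 ?mul1r.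
congr (_ * _ * _); first congr (cintegral mu (cgauss _ 0));
  by apply: complexP; rewrite !reimE /=; ring.
Qed.

Lemma cintegral_cgauss_sqr A : 0 < Re A -> cintegral mu (cgauss A 0) ^+ 2 * A = pi%:C.
Proof.
move=> A0; have := @cintegral_cgauss_scaled A 1 A0 ltr01.
by rewrite rmorph1 mul1r sqrtr1 divr1 expr2.
Qed.

Lemma cintegral_cgauss_neq0 A : 0 < Re A -> cintegral mu (cgauss A 0) != 0.
Proof.
move=> A0; apply/eqP => J0; have := cintegral_cgauss_sqr A0.
rewrite J0 expr0n mul0r => /eqP; rewrite eq_sym eq_complex /= => /andP[+ _].
by rewrite gt_eqF // pi_gt0.
Qed.

Lemma cintegral_cgaussJ A : 0 < Re A ->
  cintegral mu (cgauss A^* 0) = (cintegral mu (cgauss A 0))^*.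
Proof.
move=> A0; rewrite -cintegralJ; last first.
  have := @cintegrable_cgauss _ (fun=> 1) A 0 A0 (subgaussian_cst _) (cmeasurable_cst _ _).
  by under [fun x => _ * _]funext do rewrite mul1r.
apply: cintegral_ext => x; rewrite /cgauss !mul0r !addr0 -cexpJ.
by rewrite rmorphN rmorphM rmorphXn /= conjC_real.
Qed.

(* [A] and [d / A] have conjugate arguments, so the two branches of the square
   root of [pi / A] cancel. *)
Lemma cintegral_cgauss_inv A (d : R) : 0 < Re A -> 0 < d ->
  cintegral mu (cgauss A 0) * cintegral mu (cgauss (d%:C / A) 0) =
  (pi / Num.sqrt d)%:C.
Proof.
move=> A0 d0; set J := cintegral mu (cgauss A 0).
have An0 : A != 0 by apply: contraTneq A0 => ->; rewrite ltxx.
set N := normc A; have N0 : 0 < N by rewrite normc_gt0.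
have NC : N%:C != 0 by rewrite eq_complex /= gt_eqF.
have AA : A * A^* = (N ^+ 2)%:C.
  by rewrite -normCK normcE rmorphXn.
have AJ : A^* != 0 by rewrite conjC_eq0.
have cd : 0 < d / N ^+ 2 by rewrite divr_gt0 // exprn_gt0.
have -> : d%:C / A = (d / N ^+ 2)%:C * A^*.
  rewrite rmorphM fmorphV /= -AA; field; by rewrite An0 AJ.
have ReJA : 0 < Re A^* by rewrite ReJ.
have := cintegral_cgauss_scaled ReJA cd; rewrite cintegral_cgaussJ // -/J.
set X := cintegral mu _ => hX.
have Jn0 : J != 0 by exact: cintegral_cgauss_neq0.
have JJ0 : J^* != 0 by rewrite conjC_eq0.
have J2 := cintegral_cgauss_sqr A0; rewrite -/J in J2.
have JN : J * J^* = (pi / N)%:C.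
  rewrite -normCK normcE -rmorphXn; congr (_)%:C.
  have := congr1 (fun z : R[i] => normc z) J2; rewrite normcM normcX normc_real ger0_norm ?pi_ge0 //.
  by move=> <-; rewrite -/N; field; rewrite gt_eqF.
have -> : J * X = J * J * A * (X * J^* * A^*) / ((J * J^*) * (A * A^*)).
  by field; rewrite Jn0 JJ0 An0 AJ.
rewrite hX JN AA -expr2 J2 -!rmorphM -fmorphV -!rmorphM; congr (_)%:C.
rewrite sqrtrM ?ltW // sqrtrV ?exprn_ge0 ?ltW // sqrtr_sqr gtr0_norm //.
have sd0 : Num.sqrt d != 0 by rewrite gt_eqF // sqrtr_gt0.
have pi0 : pi != 0 :> R by rewrite gt_eqF // pi_gt0.
have Nn0 : N != 0 by rewrite gt_eqF.
move: (pi : R) pi0 => p p0.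
by field; rewrite sd0 Nn0 p0.
Qed.

End GaussianConstant.

(** * Gaussian integrals over the complex plane *)

Section ComplexGaussianPlane.
Context {R : realType}.
Local Notation mu := (@lebesgue_measure R).
Local Notation RR := (measurableTypeR R * measurableTypeR R)%type.
Implicit Types (f : R * R -> R[i]).

Lemma cmeasurable_plane : cmeasurable (fun p : RR => p.1 +i* p.2).
Proof. by apply: cmeasurable_pair; [exact: measurable_fst|exact: measurable_snd]. Qed.

Section GaussBounded.
Variables (f : R * R -> R[i]) (c e : R).
Hypothesis e0 : 0 < e.
Hypothesis mf : cmeasurable (f : RR -> R[i]).
Hypothesis fc : forall p, normc (f p) <= c * expR (- (e * normc (p.1 +i* p.2) ^+ 2)).

Lemma cintegrable_area_bounded : cintegrable area f.
Proof. exact: (cintegrable_dom mf (integrable_gauss_area c e0)). Qed.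

Let c0 : 0 <= c.
Proof.
have := le_trans (normc_ge0 _) (fc (0, 0)).
by rewrite pmulr_lge0 // expR_gt0.
Qed.

Let line : mu.-integrable setT (EFin \o (fun x => c * expR (- (e * x ^+ 2)))).
Proof. by have [ig _] := integral_gauss e0; exact: (integrableZl measurableT c ig). Qed.

Lemma cintegrable_slice2 y : cintegrable mu (fun x => f (x, y)).
Proof.
apply: (cintegrable_dom _ line) => [|x].
  exact: (cmeasurable_comp mf (measurable_pair2 y)).
rewrite (le_trans (fc _)) // ler_wpM2l // ler_expR normc_sqr /= lerN2 ler_pM2l //.
by rewrite lerDl sqr_ge0.
Qed.

Lemma cintegral_area :
  cintegral area f = cintegral mu (fun y => cintegral mu (fun x => f (x, y))).
Proof.
exact: (cintegral_prod21 cintegrable_area_bounded cintegrable_slice2).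
Qed.

End GaussBounded.

Implicit Types (be ga k q : R[i]).

Definition plane_exponent be ga (w : R[i]) : R[i] :=
  - (w * w^*) - be * w^* ^+ 2 / 2 + ga * w ^+ 2 / 2.

(** For [be] and [ga] in the open unit disk the coefficient is positive, which makes the plane
    integral converge. *)
Lemma Re_plane_exponent be ga w :
  Re (plane_exponent be ga w) <=
  - ((1 - (normc be + normc ga) / 2) * normc w ^+ 2).
Proof.
rewrite /plane_exponent 2!ReD.
have -> : Re (- (w * w^*)) = - normc w ^+ 2.
  by rewrite -normCK normcE -rmorphXn -rmorphN.
have h1 : Re (- (be * w^* ^+ 2 / 2)) <= normc be / 2 * normc w ^+ 2.
  rewrite (le_trans (ler_norm _)) // (le_trans (normc_Re_le _)) // normcN !normcM.
  rewrite normcJ Normc.normcV -(rmorph_nat (real_complex R)) normc_real ger0_norm //.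
  by rewrite le_eqVlt; apply/orP; left; apply/eqP; field.
have h2 : Re (ga * w ^+ 2 / 2) <= normc ga / 2 * normc w ^+ 2.
  rewrite (le_trans (ler_norm _)) // (le_trans (normc_Re_le _)) // !normcM.
  rewrite Normc.normcV -(rmorph_nat (real_complex R)) normc_real ger0_norm //.
  by rewrite le_eqVlt; apply/orP; left; apply/eqP; field.
lra.
Qed.

Lemma gauss_weightE (p : R * R) (v : R[i]) :
  (gauss_weight p)%:C * cexp v =
  (pi^-1)%:C * cexp (v - (p.1 +i* p.2) * (p.1 +i* p.2)^*).
Proof.
rewrite /gauss_weight (rmorphM (real_complex R)) /= -cexp_real -mulrA -cexpD; congr (_ * cexp _).
rewrite addrC; congr (_ + _).
by apply: complexP; rewrite !reimE /=; ring.
Qed.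

(** For the kernel of T at [z], the coefficients are [be = t^* / s] and [q = z / s], once the factor
    depending on [z] alone is taken out. *)
Definition gauss_term be ga q (g : R[i] -> R[i]) (w : R[i]) : R[i] :=
  g w * cexp (q * w^* - be * w^* ^+ 2 / 2 + ga * w ^+ 2 / 2).

Lemma gauss_weight_plane be ga q (g : R[i] -> R[i]) (p : R * R) :
  let w := p.1 +i* p.2 in
  (gauss_weight p)%:C * gauss_term be ga q g w =
  (pi^-1)%:C * g w * cexp (q * w^*) * cexp (plane_exponent be ga w).
Proof.
move=> w; rewrite /gauss_term mulrCA gauss_weightE -/w mulrCA mulrA -[RHS]mulrA -cexpD.
by congr (_ * cexp _); rewrite /plane_exponent; ring.
Qed.

Lemma gauss_plane_bound be ga q (g : R[i] -> R[i]) :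
  normc be < 1 -> normc ga < 1 -> subgaussian g ->
  exists2 e, 0 < e & exists c, forall p : R * R,
    normc ((gauss_weight p)%:C * gauss_term be ga q g (p.1 +i* p.2))
    <= c * expR (- (e * normc (p.1 +i* p.2) ^+ 2)).
Proof.
move=> be1 ga1 sg; set e := 1 - (normc be + normc ga) / 2.
have e0 : 0 < e by rewrite /e; lra.
exists (e / 2); first lra.
have sG : subgaussian (fun w => (pi^-1)%:C * g w * cexp (q * w^*)).
  apply: subgaussianM; first by apply: subgaussianM => //; exact: subgaussian_cst.
  by apply: (@subgaussian_cexp _ _ (normc q)) => z; rewrite normcM normcJ.
have [c c0 cb] := subgaussian_bound e0 sG (Re_plane_exponent be ga).
exists c => p /=.
by have := cb (p.1 +i* p.2); rewrite -(gauss_weight_plane be ga q g p).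
Qed.

Lemma cmeasurable_gauss_plane be ga q (g : R[i] -> R[i]) :
  cmeasurable (fun p : RR => g (p.1 +i* p.2)) ->
  cmeasurable (fun p : RR =>
    (gauss_weight p)%:C * gauss_term be ga q g (p.1 +i* p.2)).
Proof.
move=> mg; have mw := cmeasurable_plane; have mc k := @cmeasurable_cst R _ RR k.
apply: cmeasurableM.
  apply: cmeasurable_real; apply: measurable_funM => //.
  apply: measurableT_comp => //; apply: measurableT_comp => //.
  by apply: measurable_funD; apply: measurable_funX;
    [exact: measurable_fst|exact: measurable_snd].
apply: cmeasurableM => //; apply: cmeasurable_cexp.
have mwJ := cmeasurableJ mw.
apply: cmeasurableD; last first.
  apply: cmeasurableM; last exact: mc.
  by apply: cmeasurableM; [exact: mc|exact: cmeasurableX].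
apply: cmeasurableD; first by apply: cmeasurableM; [exact: mc|].
apply: cmeasurableN; apply: cmeasurableM; last exact: mc.
by apply: cmeasurableM; [exact: mc|exact: cmeasurableX].
Qed.

(** Integration in [x] and then in [y], each by the formula on the line. The quadratic coefficients
    are [A1] and [A2 = d / A1], so for real positive [d] the two Gaussian constants multiply to pi /
    sqrt d and no branch remains. *)
Lemma gauss_cintegral_hp be ga q k n (d : R) :
  normc be < 1 -> normc ga < 1 -> 0 < d -> d%:C = 1 + be * ga ->
  gauss_cintegral (gauss_term be ga q (fun w => hp k w n)) =
  (Num.sqrt d)^-1%:C * cexp (ga * q ^+ 2 / (2 * d%:C)) *
    hp (k - be / d%:C) (q / d%:C) n.
Proof.
move=> be1 ga1 d0 dE.
have sh : subgaussian (fun w : R[i] => hp k w n).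
  rewrite (_ : (fun w : R[i] => _) = (fun w => hp k (1 * w + 0) n)); last first.
    by apply/funext => w; rewrite mul1r addr0.
  exact: subgaussian_hp.
have mh : cmeasurable (fun p : RR => hp k (p.1 +i* p.2) n).
  exact/cmeasurable_hp/cmeasurable_plane.
have [e e0 [c fc]] := gauss_plane_bound q be1 ga1 sh.
rewrite /gauss_cintegral (cintegral_area e0 (cmeasurable_gauss_plane be ga q mh) fc).
pose I : R[i] := 0 +i* 1.
(* The identities below hold only modulo this one: each is proved by exhibiting the difference of
   its sides as a multiple of [I * I + 1]. *)
have I2 : I * I = -1 by apply: complexP; rewrite !reimE /=; ring.
have wE (x y : R) : x +i* y = x%:C + I * y%:C.
  by apply: complexP; rewrite !reimE /=; ring.
have wJE (x y : R) : (x +i* y)^* = x%:C - I * y%:C.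
  by apply: complexP; rewrite !reimE /=; ring.
have piC : (pi : R)%:C != 0 by rewrite eq_complex /= gt_eqF // pi_gt0.
have dC : d%:C != 0 by rewrite eq_complex /= gt_eqF.
pose A1 : R[i] := 1 + (be - ga) / 2.
have A10 : 0 < Re A1.
  have h1 := normc_Re_le be; have h2 := normc_Re_le ga.
  have := ler_norm (Re ga); have := ler_norm (- Re be); rewrite normrN => h3 h4.
  rewrite /A1 -(rmorph_nat (real_complex R)) -fmorphV /= !reimE /= mulr0 subr0.
  lra.
have A1n : A1 != 0 by apply: contraTneq A10 => ->; rewrite ltxx.
have A1x2 : 2 + (be - ga) != 0.
  have -> : 2 + (be - ga) = 2 * A1 by rewrite /A1; field.
  by rewrite mulf_neq0 // pnatr_eq0.
pose A2 : R[i] := d%:C / A1.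
have A20 : 0 < Re A2.
  rewrite /A2 ReM /= mul0r subr0 mulr_gt0 //.
  rewrite /GRing.inv /=; case: (A1) A10 A1n => a b /= a0 _.
  by rewrite divr_gt0 // ltr_wpDr ?sqr_ge0 // exprn_gt0.
have A2n : A2 != 0 by rewrite mulf_neq0 ?invr_neq0.
(* In [x] the exponent is -A1 x^2 + B1 x + C1. Integration in [x] leaves -A2 y^2 + B2 y + q^2 / (4
   A1) and a Hermite polynomial with the data [k1], [al2], [eta2]. *)
pose B1 (y : R) : R[i] := q + I * (be + ga) * y%:C.
pose C1 (y : R) : R[i] := - (1 - (be - ga) / 2) * y%:C ^+ 2 - I * q * y%:C.
pose B2 : R[i] := - I * q * (1 - ga) / A1.
pose al2 : R[i] := I * (1 + be) / A1.
pose eta2 : R[i] := q / (2 * A1).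
pose k1 : R[i] := k + 1 / (2 * A1).
have inner (y : R) : cintegral mu (fun x : R => (gauss_weight (x, y))%:C *
      gauss_term be ga q (fun w => hp k w n) (x +i* y)) =
    (pi^-1)%:C * cintegral mu (cgauss A1 0) * cexp (q ^+ 2 / (4 * A1)) *
      (hp k1 (al2 * y%:C + eta2) n * cgauss A2 B2 y).
  have ih : cintegrable mu (fun x : R => hp k (1 * x%:C + I * y%:C) n * cgauss A1 (B1 y) x).
    have := @cintegrable_hp_cgauss _ (fun=> 1) A1 (B1 y) k 1 (I * y%:C) n A10
      (subgaussian_cst _) (cmeasurable_cst _ _).
    by under [fun x => _]funext do rewrite mul1r.
  transitivity (cintegral mu (fun x : R => (pi^-1)%:C * cexp (C1 y) *
      (hp k (1 * x%:C + I * y%:C) n * cgauss A1 (B1 y) x))).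
    apply: cintegral_ext => x; rewrite /gauss_term mulrCA gauss_weightE /cgauss /=.
    rewrite wE mul1r [RHS]mulrCA -!mulrA -cexpD; congr (_ * (_ * cexp _)).
    rewrite -wE wJE wE /A1 /B1 /C1.
    apply/eqP; rewrite -subr_eq0; apply/eqP.
    transitivity ((I * I + 1) * ((1 - (be - ga) / 2) * y%:C ^+ 2)); first by field.
    by rewrite I2 addNr mul0r.
  rewrite (cintegralZ _ ih) (cintegral_hp_cgauss _ _ _ _ _ A10) (cintegral_cgaussB _ A10).
  have -> : k + 1 ^+ 2 / (2 * A1) = k1 by rewrite expr1n.
  have -> : I * y%:C + 1 * B1 y / (2 * A1) = al2 * y%:C + eta2.
    by rewrite /B1 /al2 /eta2 /A1; field; rewrite ?A1x2.
  have eE : cexp (C1 y) * cexp (B1 y ^+ 2 / (4 * A1)) =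
      cexp (q ^+ 2 / (4 * A1)) * cgauss A2 B2 y.
    rewrite /cgauss -!cexpD; congr cexp.
    apply/eqP; rewrite -subr_eq0; apply/eqP.
    transitivity ((I * I + 1) * ((be + ga) ^+ 2 * y%:C ^+ 2 / (4 * A1))).
      by rewrite /C1 /B1 /A2 /B2 dE /A1; field; rewrite ?A1x2 -?dE ?dC.
    by rewrite I2 addNr mul0r.
  transitivity ((pi^-1)%:C * cintegral mu (cgauss A1 0) *
    hp k1 (al2 * y%:C + eta2) n * (cexp (C1 y) * cexp (B1 y ^+ 2 / (4 * A1)))); first by ring.
  by rewrite eE; ring.
transitivity (cintegral mu (fun y : R => (pi^-1)%:C * cintegral mu (cgauss A1 0) *
   cexp (q ^+ 2 / (4 * A1)) * (hp k1 (al2 * y%:C + eta2) n * cgauss A2 B2 y))).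
  exact: cintegral_ext.
have io : cintegrable mu (fun y : R => hp k1 (al2 * y%:C + eta2) n * cgauss A2 B2 y).
  have := @cintegrable_hp_cgauss _ (fun=> 1) A2 B2 k1 al2 eta2 n A20
    (subgaussian_cst _) (cmeasurable_cst _ _).
  by under [fun x => _]funext do rewrite mul1r.
rewrite (cintegralZ _ io) (cintegral_hp_cgauss _ _ _ _ _ A20) (cintegral_cgaussB _ A20).
have dn : 1 + be * ga != 0 by rewrite -dE.
have -> : k1 + al2 ^+ 2 / (2 * A2) = k - be / d%:C.
  apply/eqP; rewrite -subr_eq0; apply/eqP.
  transitivity ((I * I + 1) * ((1 + be) ^+ 2 / (A1 ^+ 2 * (2 * A2)))).
    by rewrite /k1 /al2 /A2 dE /A1; field; rewrite ?A1x2 ?dn.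
  by rewrite I2 addNr mul0r.
have -> : eta2 + al2 * B2 / (2 * A2) = q / d%:C.
  apply/eqP; rewrite -subr_eq0; apply/eqP.
  transitivity ((I * I + 1) * (- q * (1 + be) * (1 - ga) / (A1 ^+ 2 * (2 * A2)))).
    by rewrite /eta2 /al2 /B2 /A2 dE /A1; field; rewrite ?A1x2 ?dn.
  by rewrite I2 addNr mul0r.
have eE : cexp (q ^+ 2 / (4 * A1)) * cexp (B2 ^+ 2 / (4 * A2)) =
    cexp (ga * q ^+ 2 / (2 * d%:C)).
  rewrite -!cexpD; congr cexp; apply/eqP; rewrite -subr_eq0; apply/eqP.
  transitivity ((I * I + 1) * (q ^+ 2 * (1 - ga) ^+ 2 / (4 * A1 ^+ 2 * A2))).
    by rewrite /B2 /A2 dE /A1; field; rewrite ?A1x2 ?dn.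
  by rewrite I2 addNr mul0r.
have JJ := cintegral_cgauss_inv A10 d0; rewrite -/A2 in JJ.
have sdE : (Num.sqrt d)^-1%:C = (pi^-1)%:C * (pi / Num.sqrt d)%:C.
  by rewrite -rmorphM mulKf // gt_eqF // pi_gt0.
rewrite -eE sdE -JJ; move: (hp _ _ _) (cexp _) (cexp _) (pi^-1)%:C => u v w z.
by ring.
Qed.

End ComplexGaussianPlane.

(** * Action of the kernels on Hermite polynomials times Gaussians *)

Section Kernels.
Context {R : realType}.
Local Notation RR := (measurableTypeR R * measurableTypeR R)%type.
Implicit Types (s t ga k z w q be : R[i]).

Definition hpgauss k ga n w : R[i] := hp k w n * cexp (ga * w ^+ 2 / 2).

(** Leaves out the inverse root of [s], so that conjugation turns it into a kernel of the same
    form. *)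
Definition kexp s t z w : R[i] :=
  cexp ((t * z ^+ 2 - (t * w ^+ 2)^* + 2 * z * w^*) / (2 * s)).

Lemma kernelSTE s t z w : kernelST s t z w = (sqrtc s)^-1 * kexp s t z w.
Proof. by []. Qed.

(* The adjoint kernel is, up to a constant, the kernel with parameters
   [(s^*, - t)]. *)
Lemma kexpJ s t z w : (kexp s t z w)^* = kexp s^* (- t) w z.
Proof.
rewrite /kexp -cexpJ; congr cexp.
rewrite !(rmorphM, rmorphD, rmorphN, rmorphXn, fmorphV) /= !conjCK !conjC1.
by congr (_ / _); ring.
Qed.

Lemma subgaussian_hp1 k n : subgaussian (fun w : R[i] => hp k w n).
Proof.
rewrite (_ : (fun w : R[i] => _) = (fun w => hp k (1 * w + 0) n)).
  exact: subgaussian_hp.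
by apply/funext => w; rewrite mul1r addr0.
Qed.

Lemma cintegrable_gauss_term be ga q k n : normc be < 1 -> normc ga < 1 ->
  cintegrable area (fun p => (gauss_weight p)%:C *
    gauss_term be ga q (fun w => hp k w n) (p.1 +i* p.2)).
Proof.
move=> be1 ga1; have [e e0 [c fc]] := gauss_plane_bound q be1 ga1 (@subgaussian_hp1 k n).
apply: (cintegrable_area_bounded e0 _ fc).
by apply: cmeasurable_gauss_plane; exact/cmeasurable_hp/cmeasurable_plane.
Qed.

Lemma gauss_cintegralZ (c : R[i]) (f : R[i] -> R[i]) :
  cintegrable area (fun p => (gauss_weight p)%:C * f (p.1 +i* p.2)) ->
  gauss_cintegral (fun w => c * f w) = c * gauss_cintegral f.
Proof.
move=> fi; rewrite /gauss_cintegral -(cintegralZ c fi).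
by apply: cintegral_ext => p; rewrite mulrCA.
Qed.

(** The plane integral returns [hp] at the point z / (s d); [hp_scale] brings it back to [z], which
    costs the factor (s d)^(-n) and rescales the parameter [k] by (s d)^2. *)
Lemma gauss_cintegral_kexp s t k ga z n (d : R) :
  s != 0 -> normc (t^* / s) < 1 -> normc ga < 1 -> 0 < d ->
  d%:C = 1 + t^* / s * ga ->
  gauss_cintegral (fun w => kexp s t z w * hpgauss k ga n w) =
  (Num.sqrt d)^-1%:C * ((s * d%:C) ^+ n)^-1 *
    hpgauss ((s * d%:C) ^+ 2 * (k - t^* / (s * d%:C))) (t / s + ga / (s ^+ 2 * d%:C)) n z.
Proof.
move=> s0 be1 ga1 d0 dE; have dC : d%:C != 0 by rewrite eq_complex /= gt_eqF.
transitivity (gauss_cintegral (fun w => cexp (t / s * z ^+ 2 / 2) *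
    gauss_term (t^* / s) ga (z / s) (fun w => hp k w n) w)).
  congr gauss_cintegral; apply/funext => w.
  rewrite /kexp /hpgauss /gauss_term mulrCA [RHS]mulrCA -!cexpD; congr (_ * cexp _).
  by rewrite !rmorphM /=; field; rewrite s0.
rewrite gauss_cintegralZ; last exact: cintegrable_gauss_term.
rewrite (gauss_cintegral_hp _ _ _ be1 ga1 d0 dE) /hpgauss.
have -> : k - t^* / s / d%:C = k - t^* / (s * d%:C) by field; rewrite s0 dC.
set k' := k - _.
have -> : hp ((s * d%:C) ^+ 2 * k') z n = (s * d%:C) ^+ n * hp k' (z / s / d%:C) n.
  by rewrite -hp_scale; congr hp; field; rewrite s0 dC.
have -> : cexp ((t / s + ga / (s ^+ 2 * d%:C)) * z ^+ 2 / 2) =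
    cexp (t / s * z ^+ 2 / 2) * cexp (ga * (z / s) ^+ 2 / (2 * d%:C)).
  by rewrite -cexpD; congr cexp; field; rewrite s0 dC.
have sdn : (s * d%:C) ^+ n != 0 by rewrite expf_neq0 // mulf_neq0.
move: (hp _ _ _) (cexp _) (cexp _) => x y u; move: ((s * d%:C) ^+ n) sdn => v v0.
have sd : (Num.sqrt d)%:C != 0 by rewrite eq_complex /= gt_eqF // sqrtr_gt0.
by field; rewrite v0 sd.
Qed.

End Kernels.

(** * Measurability of continuous functions on the plane *)

Section PlaneMeasurability.
Context {R : realType}.
Local Notation RR := (measurableTypeR R * measurableTypeR R)%type.

(** The plane carries the product sigma-algebra, so the preimage of an open interval is written as a
    countable union of open boxes with rational corners. *)
Lemma measurable_plane_continuous (g : R * R -> R) :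
  (forall p (e : R), 0 < e -> exists2 d : R, 0 < d & forall p' : R * R,
     `|p'.1 - p.1| < d -> `|p'.2 - p.2| < d -> `|g p' - g p| < e) ->
  measurable_fun [set: RR] (g : RR -> R).
Proof.
move=> gc; apply: (measurability _ (RGenOpens.measurableE R)).
move=> _ [_ [a [b ->] <-]]; rewrite setTI.
set U := _ @^-1` _.
pose box (q : rat * rat * (rat * rat)) : set RR :=
  `]ratr q.1.1, ratr q.1.2[%classic `*` `]ratr q.2.1, ratr q.2.2[%classic.
(* An enumeration of the boxes inside [U]; a number that codes no such box contributes the empty
   set. *)
pose F (n : nat) : set RR := if (unpickle n : option (rat * rat * (rat * rat))) is Some q
  then (if `[< box q `<=` U >] then box q else set0) else set0.
have FE q : F (pickle q) = if `[< box q `<=` U >] then box q else set0.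
  by rewrite /F pickleK.
have -> : U = \bigcup_n F n.
  apply/seteqP; split => [p Up|p [n _]]; last first.
    rewrite /F; case: (unpickle n) => // q; case: ifPn => // /asboolP; exact.
  have /andP[ap pb] : a < g p < b by move: Up; rewrite /U /= in_itv.
  have e0 : 0 < Num.min (g p - a) (b - g p) by rewrite lt_min !subr_gt0 ap pb.
  have [d d0 gd] := gc p _ e0.
  have rat_left (x : R) : exists2 q : rat, x - d < ratr q & ratr q < x.
    have /rat_in_itvoo[q] : x - d < x by rewrite gtrBl.
    by rewrite in_itv /= => /andP[? ?]; exists q.
  have rat_right (x : R) : exists2 q : rat, x < ratr q & ratr q < x + d.
    have /rat_in_itvoo[q] : x < x + d by rewrite ltrDl.
    by rewrite in_itv /= => /andP[? ?]; exists q.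
  have [q1 q11 q12] := rat_left p.1; have [q2 q21 q22] := rat_right p.1.
  have [q3 q31 q32] := rat_left p.2; have [q4 q41 q42] := rat_right p.2.
  exists (pickle ((q1, q2), (q3, q4))); first exact: I.
  rewrite FE ifT; first by split => /=; rewrite in_itv /=; apply/andP; split.
  apply/asboolP => p' [/=]; rewrite !in_itv /= => /andP[h1 h2] /andP[h3 h4].
  have k1 : `|p'.1 - p.1| < d by rewrite ltr_norml; apply/andP; split; lra.
  have k2 : `|p'.2 - p.2| < d by rewrite ltr_norml; apply/andP; split; lra.
  have := gd p' k1 k2; rewrite lt_min !ltr_norml => /andP[/andP[m1 m2] /andP[m3 m4]].
  by rewrite /U /= in_itv /=; apply/andP; split; lra.
apply: bigcupT_measurable => n; rewrite /F; case: (unpickle n) => // q.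
by case: ifP => // _; apply: measurableX; exact: measurable_itv.
Qed.

End PlaneMeasurability.

(** * Entire functions *)

Section Entire.
Context {R : realType}.
Local Notation RR := (measurableTypeR R * measurableTypeR R)%type.
Implicit Types (f g : R[i] -> R[i]) (z w : R[i]).

Lemma entire_cst c : entire (fun=> c : R[i]).
Proof. by move=> z; exact: derivable_cst. Qed.

Lemma entire_id : entire (id : R[i] -> R[i]).
Proof. by move=> z; exact: derivable_id. Qed.

Lemma entireD f g : entire f -> entire g -> entire (fun z => f z + g z).
Proof. by move=> ef eg z; apply: (@derivableD _ R[i]^o R[i]^o). Qed.

Lemma entireM f g : entire f -> entire g -> entire (fun z => f z * g z).
Proof. by move=> ef eg z; apply: (@derivableM _ R[i]^o). Qed.

Lemma entireB f g : entire f -> entire g -> entire (fun z => f z - g z).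
Proof. by move=> ef eg z; apply: (@derivableB _ R[i]^o R[i]^o). Qed.

Lemma entire_comp f g : entire f -> entire g -> entire (fun z => f (g z)).
Proof.
move=> ef eg z; apply/derivable1_diffP.
apply: (@differentiable_comp _ R[i]^o R[i]^o R[i]^o g f).
  exact/derivable1_diffP.
exact/derivable1_diffP.
Qed.

Lemma entire_continuous f z (e : R) : entire f -> 0 < e ->
  exists2 d : R, 0 < d & forall w, normc (w - z) < d -> normc (f w - f z) < e.
Proof.
move=> ef e0.
have cf : {for z, continuous (f : R[i]^o -> R[i]^o)}.
  by apply: differentiable_continuous; exact/derivable1_diffP.
have eC : 0 < e%:C :> R[i] by rewrite ltcR.
move: cf => /cvgrPdist_lt /(_ _ eC) [d /= d0 fd].
(* The radius is a positive element of [R[i]], and positivity there includes being real. *)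
have [r dE] : exists r : R, d = r%:C.
  by exists (Re d); apply: complexP => //=; case: d d0 {fd} => ? ? /=; rewrite ltcE /= => /andP[/eqP].
exists r; first by move: d0; rewrite dE ltcR.
move=> w; rewrite -normcN opprB -[normc (f w - f z)]normcN opprB => wz.
by have := fd w; rewrite dE /= !normcE !ltcR; exact.
Qed.

Lemma cmeasurable_entire f : entire f -> cmeasurable (fun p : RR => f (p.1 +i* p.2)).
Proof.
move=> ef.
have main p (e : R) : 0 < e -> exists2 d : R, 0 < d & forall p' : R * R,
    `|p'.1 - p.1| < d -> `|p'.2 - p.2| < d ->
    normc (f (p'.1 +i* p'.2) - f (p.1 +i* p.2)) < e.
  move=> e0; have [d d0 fd] := entire_continuous (p.1 +i* p.2) ef e0.
  exists (d / 2); first lra.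
  move=> p' h1 h2; apply: fd; apply: (le_lt_trans (normc_le_ReIm _)).
  by rewrite !reimE /=; lra.
split; apply: measurable_plane_continuous => p e e0; have [d d0 h] := main p e e0;
    exists d => // p' h1 h2; apply: (le_lt_trans _ (h p' h1 h2)).
  by rewrite -ReN -ReD normc_Re_le.
by rewrite -ImN -ImD normc_Im_le.
Qed.

Lemma is_derive_linear_approx (f : R -> R) (x l e : R) : is_derive x 1 f l -> 0 < e ->
  exists2 d : R, 0 < d & forall h, `|h| < d -> `|f (h + x) - f x - l * h| <= e * `|h|.
Proof.
move=> [df dE] e0; move: df; rewrite /derivable => /cvg_ex[/= l' dl].
have ll' : l' = l.
  rewrite -dE /derive; apply/esym/cvg_lim => //.
move: dl; rewrite {}ll' => /cvgrPdist_le /(_ _ e0) [d /= d0 hd].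
exists d => // h hh; have [->|h0] := eqVneq h 0.
  by rewrite add0r subrr mulr0 subrr !normr0 mulr0.
have := hd h; rewrite /= sub0r normrN => /(_ hh h0).
rewrite /GRing.scale /= mulr1 => k.
have hp : 0 < `|h| by rewrite normr_gt0.
have -> : f (h + x) - f x - l * h = - h * (l - h^-1 * (f (h + x) - f x)) by field.
by rewrite normrM normrN mulrC ler_pM2r.
Qed.

Lemma cexp_linear_approx (e : R) : 0 < e ->
  exists2 d : R, 0 < d & forall h : R[i], normc h < d ->
    normc (cexp h - 1 - h) <= e * normc h.
Proof.
(* The errors add up to [9 * k * normc h]: 4 parts from the real component, 5 from the imaginary
   one. The bound [k <= 1] keeps [expR x] below 3, and [normc h < k] controls the product of
   first-order terms. *)
move=> e0; pose k := Num.min (e / 16) 1.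
have k0 : 0 < k by rewrite lt_min; apply/andP; split => //; lra.
have [k1 k2] : k <= e / 16 /\ k <= 1 by rewrite /k !ge_min !lexx orbT.
clearbody k.
have [d1 d10 h1] := is_derive_linear_approx (is_derive_expR 0) k0.
have [d2 d20 h2] := is_derive_linear_approx (is_derive_cos 0) k0.
have [d3 d30 h3] := is_derive_linear_approx (is_derive_sin 0) k0.
exists (Num.min (Num.min d1 d2) (Num.min d3 k)).
  by rewrite !lt_min d10 d20 d30 k0.
move=> h; rewrite !lt_min => /andP[/andP[n1 n2] /andP[n3 n4]].
set x := Re h; set y := Im h; set N := normc h in n1 n2 n3 n4 *.
have xN : `|x| <= N by exact: normc_Re_le.
have yN : `|y| <= N by exact: normc_Im_le.
have := h1 x (le_lt_trans xN n1); rewrite addr0 expR0 mul1r => a1.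
have := h2 y (le_lt_trans yN n2); rewrite addr0 cos0 sin0 oppr0 mul0r subr0 => a2.
have := h3 y (le_lt_trans yN n3); rewrite addr0 cos0 sin0 subr0 mul1r => a3.
apply: (le_trans (normc_le_ReIm _)); rewrite !reimE /= -/x -/y.
rewrite subr0.
set E := expR x in a1 *; set C := cos y in a2 *; set S := sin y in a3 *.
have E0 : 0 < E by exact: expR_gt0.
have x0 := normr_ge0 x; have y0 := normr_ge0 y; have N0 := normc_ge0 h; rewrite -/N in N0.
have E1 : `|E - 1| <= 2 * `|x|.
  have -> : E - 1 = (E - 1 - x) + x by ring.
  by rewrite (le_trans (ler_normD _ _)) //; nra.
have E3 : E <= 3.
  have := ler_norm (E - 1); lra.
have r1 : `|E * C - 1 - x| <= 4 * k * N.
  have -> : E * C - 1 - x = (E - 1 - x) + E * (C - 1) by ring.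
  rewrite (le_trans (ler_normD _ _)) // normrM (gtr0_norm E0).
  have : E * `|C - 1| <= 3 * (k * `|y|) by apply: ler_pM => //; exact: ltW.
  have : k * `|y| <= k * N by rewrite ler_pM2l.
  have : k * `|x| <= k * N by rewrite ler_pM2l.
  lra.
have r2 : `|E * S - y| <= 5 * k * N.
  have -> : E * S - y = E * (S - y) + (E - 1) * y by ring.
  rewrite (le_trans (ler_normD _ _)) // !normrM (gtr0_norm E0).
  have : E * `|S - y| <= 3 * (k * `|y|) by apply: ler_pM => //; exact: ltW.
  have : k * `|y| <= k * N by rewrite ler_pM2l.
  have : `|E - 1| * `|y| <= (2 * k) * N.
    by apply: ler_pM => //; lra.
  lra.
have : 9 * k * N <= e * N by rewrite ler_wpM2r //; lra.
lra.
Qed.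

Lemma entire_cexp : entire (@cexp R).
Proof.
move=> z; apply/cvg_ex; exists (cexp z); apply/cvgrPdist_le => /= e e0.
have [r eE] : exists r : R, e = r%:C.
  by exists (Re e); apply: complexP => //=; case: e e0 => ? ? /=; rewrite ltcE /= => /andP[/eqP].
have r0 : 0 < r by move: e0; rewrite eE ltcR.
have cz : 0 < normc (cexp z) by rewrite normc_gt0 cexp_neq0.
have [d d0 hd] := cexp_linear_approx (divr_gt0 r0 cz).
exists d%:C; first by rewrite /= ltcR.
move=> h /=; rewrite sub0r normrN normcE ltcR => hh h0.
rewrite eE normcE lecR /GRing.scale /= mulr1 cexpD.
have -> : cexp z - h^-1 * (cexp h * cexp z - cexp z) =
   - (cexp z * h^-1 * (cexp h - 1 - h)) by field.
have h1 : 0 < normc h by rewrite normc_gt0.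
rewrite normcN !normcM Normc.normcV.
apply: (@le_trans _ _ (normc (cexp z) * (normc h)^-1 * (r / normc (cexp z) * normc h))).
  by rewrite ler_wpM2l ?hd // mulr_ge0 ?invr_ge0 ?normc_ge0.
by rewrite le_eqVlt; apply/orP; left; apply/eqP; field; rewrite !gt_eqF.
Qed.

Lemma entire_hpgauss k ga n : entire (@hpgauss R k ga n).
Proof.
have eh : entire (fun w : R[i] => hp k w n).
  elim/hp_ind2: n => [||n H0 H1]; [exact: entire_cst|exact: entire_id|].
  exact: (entireD (entireM entire_id H1) (entireM (@entire_cst (n.+1%:R * k)) H0)).
have ew : entire (fun w : R[i] => ga * (w * w) / 2).
  exact: (entireM (entireM (@entire_cst ga) (entireM entire_id entire_id)) (@entire_cst 2^-1)).
exact: (entireM eh (entire_comp entire_cexp ew)).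
Qed.

End Entire.

(** * Fock space: definiteness of the inner product and uniqueness of the adjoint *)

Section FockSpace.
Context {R : realType}.
Local Notation RR := (measurableTypeR R * measurableTypeR R)%type.
Local Notation mu := (@lebesgue_measure R).
Implicit Types (f g h : R[i] -> R[i]) (s t z w : R[i]).

Lemma gauss_weight_ge0 (p : R * R) : 0 <= gauss_weight p.
Proof. by rewrite mulr_ge0 ?invr_ge0 ?pi_ge0 ?expR_ge0. Qed.

Lemma gauss_weight_normc (p : R * R) :
  gauss_weight p = pi^-1 * expR (- normc (p.1 +i* p.2) ^+ 2).
Proof. by rewrite normc_sqr. Qed.

Lemma measurable_gauss_weight : measurable_fun setT (gauss_weight : RR -> R).
Proof.
apply: measurable_funM => //; apply: measurableT_comp => //.
apply: measurableT_comp => //.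
by apply: measurable_funD; apply: measurable_funX;
  [exact: measurable_fst|exact: measurable_snd].
Qed.

Lemma fockP f : fock f <-> entire f /\
  area.-integrable setT (fun p => (gauss_weight p * normc (f (p.1 +i* p.2)) ^+ 2)%:E).
Proof.
split=> [[ef fi]|[ef /integrable_lty fi]]; split => //; last exact: fi.
have mf := cmeasurable_entire ef.
apply/integrableP; split.
  apply/measurable_EFinP; apply: measurable_funM; first exact: measurable_gauss_weight.
  by apply: measurable_funX; exact: (measurable_normc mf).
rewrite (eq_integral (fun p : RR => (gauss_weight p * normc (f (p.1 +i* p.2)) ^+ 2)%:E)) //.
by move=> p _; rewrite gee0_abs // lee_fin mulr_ge0 ?gauss_weight_ge0 ?sqr_ge0.
Qed.

Lemma fockB f g : fock f -> fock g -> fock (fun z => f z - g z).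
Proof.
move=> /fockP[ef fi] /fockP[eg gi]; have efg := entireB ef eg.
apply/fockP; split => //.
have i2 := integrableD measurableT (integrableZl measurableT 2 fi)
  (integrableZl measurableT 2 gi).
have mfg := cmeasurable_entire efg.
apply: (le_integrable _ _ _ i2) => //.
  apply/measurable_EFinP; apply: measurable_funM; first exact: measurable_gauss_weight.
  by apply: measurable_funX; exact: (measurable_normc mfg).
move=> p _ /=; rewrite lee_fin; have W := gauss_weight_ge0 p.
set z := _ +i* _; set W1 := gauss_weight p in W *.
rewrite ger0_norm; last by rewrite mulr_ge0 ?sqr_ge0.
apply: le_trans (ler_norm _).
have := ler_normcD (f z) (- g z); rewrite normcN => h.
rewrite [leRHS](_ : _ = W1 * (2 * normc (f z) ^+ 2 + 2 * normc (g z) ^+ 2)); last by ring.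
rewrite ler_wpM2l //.
have := normc_ge0 (f z - g z); have := normc_ge0 (f z); have := normc_ge0 (g z).
have := sqr_ge0 (normc (f z) - normc (g z)).
nra.
Qed.

Lemma fockZ c f : fock f -> fock (fun z => c * f z).
Proof.
move=> /fockP[ef fi]; apply/fockP; split; first exact: (entireM (@entire_cst R c) ef).
have := integrableZl measurableT (normc c ^+ 2) fi.
congr (_.-integrable _ _); apply/funext => p /=.
by rewrite normcM exprMn -EFinM; congr EFin; ring.
Qed.

Lemma cmeasurable_gauss_entire f g : entire f -> entire g ->
  cmeasurable (fun p : RR =>
    (gauss_weight p)%:C * (f (p.1 +i* p.2) * (g (p.1 +i* p.2))^*)).
Proof.
move=> /cmeasurable_entire mf /cmeasurable_entire mg.
apply: cmeasurableM; first by apply: cmeasurable_real; exact: measurable_gauss_weight.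
by apply: cmeasurableM => //; exact: cmeasurableJ.
Qed.

Lemma cintegrable_fock f g : fock f -> fock g ->
  cintegrable area (fun p =>
    (gauss_weight p)%:C * (f (p.1 +i* p.2) * (g (p.1 +i* p.2))^*)).
Proof.
move=> /fockP[ef fi] /fockP[eg gi].
apply: (cintegrable_dom _ (integrableD measurableT fi gi)).
  exact: cmeasurable_gauss_entire.
move=> p /=; have W := gauss_weight_ge0 p; rewrite normcM normc_real ger0_norm //.
rewrite -mulrDr ler_wpM2l // normcM normcJ.
have := normc_ge0 (f (p.1 +i* p.2)); have := normc_ge0 (g (p.1 +i* p.2)).
have := sqr_ge0 (normc (f (p.1 +i* p.2)) - normc (g (p.1 +i* p.2))).
nra.
Qed.

Lemma area_square (x y d : R) : 0 < d ->
  area (`]x - d, x + d[%classic `*` `]y - d, y + d[%classic) = ((d *+ 2) ^+ 2)%:E.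
Proof.
move=> d0; pose I (u : R) : set (measurableTypeR R) := `]u - d, u + d[%classic.
have h (u : R) : mu (I u) = (d *+ 2)%:E.
  rewrite lebesgue_measure_itv /= lte_fin ifT; last by lra.
  by rewrite -EFinD; congr EFin; rewrite mulr2n; ring.
have mI (u : R) : measurable (I u) by exact: measurable_itv.
transitivity (mu (I x) * mu (I y))%E.
  exact: (product_measure1E mu mu (mI x) (mI y)).
by rewrite !h.
Qed.

(** By continuity a nonzero value persists on a square, which would lie in a null set although its
    area is positive. *)
Lemma fock_dot_eq0 f : fock f -> fock_dot f f = 0 -> f = fun=> 0.
Proof.
move=> ff f0; have [ef fi] := (fockP f).1 ff.
pose G (p : RR) := gauss_weight p * normc (f (p.1 +i* p.2)) ^+ 2.
have G0 p : 0 <= G p by rewrite mulr_ge0 ?gauss_weight_ge0 ?sqr_ge0.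
have GE p : (gauss_weight p)%:C * (f (p.1 +i* p.2) * (f (p.1 +i* p.2))^*) = (G p)%:C.
  by rewrite -normCK normcE -rmorphXn -rmorphM.
have iG0 : (\int[area]_p `|(G p)%:E| = 0)%E.
  have := congr1 (@complex.Re R) f0.
  rewrite /fock_dot /gauss_cintegral /=; under eq_Rintegral do rewrite GE.
  move=> /= h; rewrite -[LHS]fineK; last first.
    exact: (integrable_fin_num measurableT (integrable_abse fi)).
  rewrite (eq_integral (fun p : RR => (G p)%:E)); first by rewrite -[fine _]/(\int[area]_p G p)%R h.
  by move=> p _ /=; rewrite ger0_norm.
have mG : measurable_fun setT (EFin \o G) by move: fi => /measurable_int.
have [N [mN N0 GN]] := (ae_eq_integral_abs area measurableT mG).1 iG0.
apply/funext => z; apply/eqP; apply: contraT => fz.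
have c0 : 0 < normc (f z) by rewrite normc_gt0.
have [d d0 fd] := entire_continuous z ef c0.
have d2 : 0 < d / 2 by lra.
pose B : set RR := `]Re z - d / 2, Re z + d / 2[%classic `*`
  `]Im z - d / 2, Im z + d / 2[%classic.
have mB : measurable B by apply: measurableX; exact: measurable_itv.
have BN : B `<=` N.
  move=> p [/=]; rewrite !in_itv /= => /andP[b1 b2] /andP[b3 b4]; apply: GN => /=.
  move=> /(_ I) Gp; have /eqP : G p = 0 by exact: (congr1 fine Gp).
  rewrite mulf_eq0 mulf_eq0 invr_eq0.
  rewrite (gt_eqF (expR_gt0 _)) (gt_eqF (pi_gt0 R)) /= expf_eq0 /= => /eqP /Normc.eq0_normc fp.
  have := fd (p.1 +i* p.2); rewrite fp sub0r normcN ltxx.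
  suff -> : normc (p.1 +i* p.2 - z) < d by move=> /(_ isT).
  apply: (le_lt_trans (normc_le_ReIm _)); rewrite !reimE /=.
  have : `|p.1 - Re z| < d / 2 by rewrite ltr_norml; apply/andP; split; lra.
  have : `|p.2 - Im z| < d / 2 by rewrite ltr_norml; apply/andP; split; lra.
  lra.
have : (area B <= area N)%E by apply: le_measure; rewrite ?inE.
rewrite N0 /B area_square // lee_fin leNgt exprn_gt0 // pmulrn_lgt0 //.
Qed.

(** The difference [d] of two candidates has <d, d> = <A d, g> - <A d, g> = 0, so exhibiting one
    candidate computes the adjoint. *)
Lemma fock_adjointE (A : (R[i] -> R[i]) -> (R[i] -> R[i])) g h : fock g -> fock h ->
  (forall f, fock f -> fock_dot (A f) g = fock_dot f h) -> fock_adjoint A g = h.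
Proof.
move=> fg fh Ah; rewrite /fock_adjoint.
apply: xget_unique; first by split.
move=> h' [_ fh' Ah'].
pose d z := h' z - h z.
have fd : fock d by exact: fockB.
suff d0 : d = fun=> 0.
  by apply/funext => z; apply/eqP; rewrite -subr_eq0; apply/eqP; exact: (congr1 (fun u => u z) d0).
apply: fock_dot_eq0 => //.
have i1 := cintegrable_fock fd fh'.
have i2 := cintegrableZ (-1) (cintegrable_fock fd fh).
have -> : fock_dot d d = fock_dot d h' + -1 * fock_dot d h.
  rewrite /fock_dot /gauss_cintegral -(cintegralZ _ (cintegrable_fock fd fh)).
  rewrite -(cintegralD i1 i2); apply: cintegral_ext => p.
  by rewrite {2}/d rmorphB /=; ring.
by rewrite -Ah // -Ah' // mulN1r subrr.
Qed.

Lemma fock_hpgauss (c k ga : R[i]) n : normc ga < 1 -> fock (fun z => c * hpgauss k ga n z).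
Proof.
move=> ga1; set f := fun z => _.
have ef : entire f by exact: (entireM (@entire_cst R c) (@entire_hpgauss R k ga n)).
apply/fockP; split => //.
(* The margin between the Gaussian weight and the squared modulus of the exponential factor; half of
   it absorbs the squared polynomial. *)
pose e := 1 - normc ga; have e0 : 0 < e by rewrite /e; lra.
have e2 : 0 < e / 2 by lra.
have sh : subgaussian (fun z : R[i] => (c * hp k z n) * (c * hp k z n)).
  by apply: subgaussianM; apply: subgaussianM;
    [exact: subgaussian_cst|exact: subgaussian_hp1|exact: subgaussian_cst|exact: subgaussian_hp1].
have [C C0 hC] := sh _ e2.
have mf := cmeasurable_entire ef.
apply: (le_integrable _ _ _ (integrable_gauss_area (pi^-1 * C) e2)) => //.
  apply/measurable_EFinP; apply: measurable_funM; first exact: measurable_gauss_weight.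
  by apply: measurable_funX; exact: (measurable_normc mf).
move=> p _; rewrite lee_fin !ger0_norm; last 2 first.
- by rewrite !mulr_ge0 ?expR_ge0 // invr_ge0 pi_ge0.
- by rewrite mulr_ge0 ?gauss_weight_ge0 ?sqr_ge0.
rewrite gauss_weight_normc; set z := _ +i* _; set N := normc z.
rewrite -[leLHS]mulrA -[leRHS]mulrA ler_pM2l ?invr_gt0 ?pi_gt0 //.
rewrite /f /hpgauss (mulrA c) (normcM (c * _)) exprMn normc_cexp -expRM_natl.
have h2 : Re (ga * z ^+ 2 / 2) <= normc ga / 2 * N ^+ 2.
  rewrite (le_trans (ler_norm _)) // (le_trans (normc_Re_le _)) // !normcM.
  rewrite Normc.normcV -(rmorph_nat (real_complex R)) normc_real ger0_norm //.
  by rewrite le_eqVlt; apply/orP; left; apply/eqP; rewrite -/N; field.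
have := hC z; rewrite normcM -/N => h3.
apply: (@le_trans _ _ (expR (- N ^+ 2) * (C * expR (e / 2 * N ^+ 2) * expR (normc ga * N ^+ 2)))).
  rewrite ler_wpM2l ?expR_ge0 // ler_pM ?sqr_ge0 ?expR_ge0 ?expr2 // ler_expR.
  by move: h2; rewrite -mulr_natl; lra.
rewrite le_eqVlt; apply/orP; left; apply/eqP.
have -> : - (e / 2 * N ^+ 2) = - N ^+ 2 + (e / 2 * N ^+ 2 + normc ga * N ^+ 2).
  by rewrite /e; field.
by rewrite !expRD; ring.
Qed.

End FockSpace.

(** For Fubini with respect to the product of two copies of [area]. *)
Lemma area_sigma_finite (R : realType) : sigma_finite setT (@area R).
Proof.
exists (fun n => `]0 - n.+1%:R, 0 + n.+1%:R[%classic `*` `]0 - n.+1%:R, 0 + n.+1%:R[%classic).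
  apply/seteqP; split => // -[x y] _; exists (Num.Def.trunc (`|x| + `|y|)) => //.
  have := truncnS_gt (`|x| + `|y|); set N := _.+1%:R => hN.
  have := normr_ge0 x; have := normr_ge0 y => y0 x0.
  have [hx hy] : `|x| < N /\ `|y| < N by lra.
  by split => /=; rewrite in_itv /= sub0r add0r -ltr_norml.
move=> n; split; first by apply: measurableX; exact: measurable_itv.
by rewrite area_square // ltry.
Qed.

(** * Exchange of integrals and the adjoint kernel *)

Section KernelFubini.
Context {R : realType}.
Local Notation RR := (measurableTypeR R * measurableTypeR R)%type.
Local Notation mu := (@lebesgue_measure R).
Implicit Types (f g h : R[i] -> R[i]) (s t z w : R[i]).

(* The exponent is a quadratic form in [z] and the conjugate of [w], whose matrix
   [[t, 1], [1, - t^* ]] / (2 s) is a multiple of a unitary matrix. *)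
Lemma normc_kernel_exponent s t z w : s != 0 ->
  normc ((t * z ^+ 2 - (t * w ^+ 2)^* + 2 * z * w^*) / (2 * s)) <=
  Num.sqrt (normc t ^+ 2 + 1) / normc s / 2 * (normc z ^+ 2 + normc w ^+ 2).
Proof.
move=> s0; set M := Num.sqrt _.
have M2 : M ^+ 2 = normc t ^+ 2 + 1 by rewrite sqr_sqrtr // addr_ge0 ?sqr_ge0.
have M0 : 0 < M by rewrite sqrtr_gt0 ltr_wpDl ?sqr_ge0.
set X := t * _ - _ + _.
(* [X] pairs the vector (z, conj w) with its image under the matrix, which is [M] times as long. The
   weighted inequality 2MAC <= M^2 A^2 + C^2, and its analogue for [B] and [D], then play the role
   of Cauchy-Schwarz. *)
have XE : X = z * (t * z + w^* ) + w^* * (z - t^* * w^* ).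
  by rewrite /X rmorphM rmorphXn /=; ring.
have hX : normc X <= M * (normc z ^+ 2 + normc w ^+ 2).
  rewrite XE; apply: (le_trans (ler_normcD _ _)); rewrite !normcM normcJ.
  set A := normc z; set B := normc w.
  have CD : normc (t * z + w^* ) ^+ 2 + normc (z - t^* * w^* ) ^+ 2 =
      M ^+ 2 * (A ^+ 2 + B ^+ 2).
    by rewrite M2 /A /B !normc_sqr !reimE; ring.
  move: CD; set C := normc (t * z + w^* ); set D := normc _ => CD.
  have h1 := sqr_ge0 (M * A - C); have h2 := sqr_ge0 (M * B - D).
  rewrite -(ler_pM2l M0).
  have -> : M * (M * (A ^+ 2 + B ^+ 2)) =
    (M ^+ 2 * (A ^+ 2 + B ^+ 2) + (C ^+ 2 + D ^+ 2)) / 2 by rewrite CD; field.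
  nra.
have sn : 0 < normc s by rewrite normc_gt0.
rewrite normcM Normc.normcV normcM -(rmorph_nat (real_complex R)) normc_real ger0_norm //.
rewrite ler_pdivrMr ?mulr_gt0 //.
have -> : M / normc s / 2 * (normc z ^+ 2 + normc w ^+ 2) * (2 * normc s) =
  M * (normc z ^+ 2 + normc w ^+ 2) by field; rewrite gt_eqF.
exact: hX.
Qed.

Variables (s t : R[i]).
Hypothesis hst : normc t ^+ 2 + 1 < normc s ^+ 2.

Lemma kernel_s_neq0 : s != 0.
Proof.
rewrite -normc_gt0 lt_neqAle normc_ge0 andbT eq_sym; apply: contraTneq hst => ->.
by rewrite expr0n /= -leNgt addr_ge0 ?sqr_ge0.
Qed.

Let s0 := kernel_s_neq0.

Let eps : R := (1 - Num.sqrt (normc t ^+ 2 + 1) / normc s) / 2.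

Let eps0 : 0 < eps.
Proof.
have sn : 0 < normc s by rewrite normc_gt0.
rewrite divr_gt0 // subr_gt0 ltr_pdivrMr // mul1r.
rewrite -(ltr_pXn2r (n := 2)) ?nnegrE ?sqrtr_ge0 ?normc_ge0 //.
by rewrite sqr_sqrtr // addr_ge0 ?sqr_ge0.
Qed.

(** The kernel consumes at most [1 / 2 - eps] of the decay 1 of each weight. Of the remaining
    [1 / 2 + eps], the half makes [f] square integrable and [eps] leaves a square integrable
    Gaussian; the product of the two is integrable. *)
Let gauss_factor f (p : R * R) : R :=
  normc (f (p.1 +i* p.2)) * expR (- ((1 / 2 + eps) * normc (p.1 +i* p.2) ^+ 2)).

Let gauss_factor_integrable f : fock f ->
  area.-integrable setT (EFin \o gauss_factor f).
Proof.
move=> /fockP[ef fi]; have mf := cmeasurable_entire ef.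
have e2 : 0 < 2 * eps by rewrite mulr_gt0.
have i2 := integrableD measurableT (integrableZl measurableT pi fi)
   (integrable_gauss_area 1 e2).
apply: (le_integrable _ _ _ i2) => //.
  apply/measurable_EFinP; apply: measurable_funM; first exact: (measurable_normc mf).
  apply: measurableT_comp => //; apply: measurableT_comp => //.
  apply: measurable_funM => //; apply: measurable_funX.
  exact: (measurable_normc cmeasurable_plane).
move=> p _ /=; rewrite lee_fin; apply: le_trans (ler_norm _).
rewrite /gauss_factor ger0_norm ?mulr_ge0 ?normc_ge0 ?expR_ge0 //.
rewrite gauss_weight_normc; set z := _ +i* _; set N := normc z; set F := normc (f z).
have -> : pi * (pi^-1 * expR (- N ^+ 2) * F ^+ 2) = (F * expR (- (N ^+ 2 / 2))) ^+ 2.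
  have pn0 : pi != 0 :> R by rewrite gt_eqF // pi_gt0.
  have -> : expR (- N ^+ 2) = expR (- (N ^+ 2 / 2)) ^+ 2.
    by rewrite -expRM_natl; congr expR; rewrite -mulr_natl; field.
  by rewrite -(mulrA pi^-1) mulVKf // exprMn mulrC.
have -> : 1 * expR (- (2 * eps * N ^+ 2)) = expR (- (eps * N ^+ 2)) ^+ 2.
  by rewrite mul1r -expRM_natl; congr expR; rewrite -mulr_natl; ring.
have -> : - ((1 / 2 + eps) * N ^+ 2) = - (N ^+ 2 / 2) + - (eps * N ^+ 2) by field.
rewrite expRD mulrA; set a := F * _; set b := expR _.
have a0 : 0 <= a by rewrite mulr_ge0 ?normc_ge0 ?expR_ge0.
have b0 : 0 <= b by exact: expR_ge0.
have := sqr_ge0 (a - b); nra.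
Qed.

Let integrand f g (P : RR * RR) : R[i] :=
  (gauss_weight P.1)%:C * (gauss_weight P.2)%:C *
  (kexp s t (P.1.1 +i* P.1.2) (P.2.1 +i* P.2.2) * f (P.2.1 +i* P.2.2) *
   (g (P.1.1 +i* P.1.2))^*).

Let normc_integrand f g P : normc (integrand f g P) <=
  pi^-1 ^+ 2 * gauss_factor g P.1 * gauss_factor f P.2.
Proof.
rewrite /integrand !normcM normcJ !normc_real !(ger0_norm (gauss_weight_ge0 _)).
rewrite !gauss_weight_normc /gauss_factor /kexp normc_cexp.
set z := P.1.1 +i* _; set w := P.2.1 +i* _; set A := normc z; set B := normc w.
set F := normc (f w); set G := normc (g z).
set E := Re _.
have hE : E <= (1 / 2 - eps) * (A ^+ 2 + B ^+ 2).
  rewrite /E (le_trans (ler_norm _)) // (le_trans (normc_Re_le _)) //.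
  rewrite (le_trans (normc_kernel_exponent _ _ _ s0)) // le_eqVlt; apply/orP; left.
  by apply/eqP; rewrite /eps -/A -/B; field; rewrite gt_eqF // normc_gt0.
have -> : (pi^-1 : R) * expR (- A ^+ 2) * (pi^-1 * expR (- B ^+ 2)) * (expR E * F * G) =
    (pi^-1 ^+ 2 * F * G) * expR (- A ^+ 2 - B ^+ 2 + E) by rewrite !expRD; ring.
have -> : pi^-1 ^+ 2 * (G * expR (- ((1 / 2 + eps) * A ^+ 2))) *
    (F * expR (- ((1 / 2 + eps) * B ^+ 2))) =
    (pi^-1 ^+ 2 * F * G) * expR (- ((1 / 2 + eps) * A ^+ 2) - ((1 / 2 + eps) * B ^+ 2)).
  by rewrite expRD; ring.
apply: ler_wpM2l; first by rewrite !mulr_ge0 ?normc_ge0 ?invr_ge0 ?pi_ge0.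
by rewrite ler_expR; move: hE; rewrite !mulrDl mulrDr; lra.
Qed.

Let cmeasurable_integrand f g : entire f -> entire g -> cmeasurable (integrand f g).
Proof.
move=> ef eg; have mz := cmeasurable_comp cmeasurable_plane (@measurable_fst _ _ RR RR).
have mw := cmeasurable_comp cmeasurable_plane (@measurable_snd _ _ RR RR).
have mc k := @cmeasurable_cst R _ (RR * RR)%type k.
apply: cmeasurableM.
  apply: cmeasurableM; apply: cmeasurable_real.
    exact: (measurableT_comp measurable_gauss_weight (@measurable_fst _ _ RR RR)).
  exact: (measurableT_comp measurable_gauss_weight (@measurable_snd _ _ RR RR)).
apply: cmeasurableM; last first.
  apply: cmeasurableJ.
  exact: (cmeasurable_comp (cmeasurable_entire eg) (@measurable_fst _ _ RR RR)).
apply: cmeasurableM; last first.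
  exact: (cmeasurable_comp (cmeasurable_entire ef) (@measurable_snd _ _ RR RR)).
apply: cmeasurable_cexp; apply: cmeasurableM; last exact: mc.
apply: cmeasurableD.
  apply: cmeasurableD.
    by apply: cmeasurableM; [exact: mc|exact: cmeasurableX].
  apply: cmeasurableN; apply: cmeasurableJ.
  by apply: cmeasurableM; [exact: mc|exact: cmeasurableX].
by apply: cmeasurableM; [apply: cmeasurableM => //; exact: mc|exact: cmeasurableJ].
Qed.

Let slice_z f g (q : RR) : fock f -> fock g ->
  cintegrable area (fun p : RR => integrand f g (p, q)).
Proof.
move=> ff fg; have [ef _] := (fockP f).1 ff; have [eg _] := (fockP g).1 fg.
have i1 := integrableZl measurableT (pi^-1 ^+ 2 * gauss_factor f q) (gauss_factor_integrable fg).
apply: (cintegrable_dom _ i1) => [|p].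
  exact: (cmeasurable_comp (cmeasurable_integrand ef eg) (measurable_pair2 q)).
by rewrite (le_trans (normc_integrand _ _ _)) // mulrAC.
Qed.

Let slice_w f g (p : RR) : fock f -> fock g ->
  cintegrable area (fun q : RR => integrand f g (p, q)).
Proof.
move=> ff fg; have [ef _] := (fockP f).1 ff; have [eg _] := (fockP g).1 fg.
have i1 := integrableZl measurableT (pi^-1 ^+ 2 * gauss_factor g p) (gauss_factor_integrable ff).
apply: (cintegrable_dom _ i1) => [|q].
  exact: (cmeasurable_comp (cmeasurable_integrand ef eg) (measurable_pair1 p)).
exact: normc_integrand.
Qed.

Let swap f g : fock f -> fock g ->
  cintegral area (fun p : RR => cintegral area (fun q : RR => integrand f g (p, q))) =
  cintegral area (fun q : RR => cintegral area (fun p : RR => integrand f g (p, q))).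
Proof.
move=> ff fg; have [ef _] := (fockP f).1 ff; have [eg _] := (fockP g).1 fg.
(* [area] is packed with its sigma-finite structure, which the Fubini lemmas ask for. *)
pose sf := isSigmaFinite.Build _ _ _ (area : set RR -> \bar R) (@area_sigma_finite R).
pose sfi := isSFinite.Build _ _ _ (area : set RR -> \bar R)
  (sfinite_measure_sigma_finite (@area_sigma_finite R)).
pose ar : {measure set RR -> \bar R} := area.
pose m := HB.pack_for (SigmaFiniteMeasure.type RR R) (Measure.sort ar) sfi sf.
have i12 := @integrable_prodM R _ _ RR RR m m _ _
  (integrableZl measurableT (pi^-1 ^+ 2) (gauss_factor_integrable fg))
  (gauss_factor_integrable ff).
have iI : cintegrable (m \x m)%E (integrand f g).
  by apply: (cintegrable_dom (cmeasurable_integrand ef eg) i12) => P; exact: normc_integrand.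
transitivity (cintegral (m \x m)%E (integrand f g)).
  apply/esym; apply: (cintegral_prod12 iI) => p; exact: slice_w.
apply: (cintegral_prod21 iI) => q; exact: slice_z.
Qed.

(** Taking 1 for [f] or [g] turns the slice lemmas into integrability of the kernel against a single
    function. *)
Let fock1 : fock (fun=> 1 : R[i]).
Proof.
have := @fock_hpgauss R 1 0 0 0; rewrite Normc.normc0 => /(_ ltr01).
by congr fock; apply/funext => z; rewrite /hpgauss /= !mul0r cexp0 !mulr1.
Qed.

Let gauss_weight_neq0 (p : R * R) : (gauss_weight p)%:C != 0 :> R[i].
Proof. by rewrite eq_complex /= gt_eqF // mulr_gt0 ?invr_gt0 ?pi_gt0 ?expR_gt0. Qed.

Let ReIm z : Re z +i* Im z = z. Proof. by case: z. Qed.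

Lemma cintegrable_kexp_r f z : fock f ->
  cintegrable area (fun q : RR =>
    (gauss_weight q)%:C * (kexp s t z (q.1 +i* q.2) * f (q.1 +i* q.2))).
Proof.
move=> ff; pose p := (Re z, Im z).
have := cintegrableZ ((gauss_weight p)%:C)^-1 (slice_w p ff fock1).
congr cintegrable; apply/funext => q; rewrite /integrand /= ReIm conjC1 mulr1.
by rewrite -(mulrA (gauss_weight p)%:C) mulKf.
Qed.

Lemma cintegrable_kexp_l g w : fock g ->
  cintegrable area (fun p : RR =>
    (gauss_weight p)%:C * (kexp s t (p.1 +i* p.2) w * (g (p.1 +i* p.2))^* )).
Proof.
move=> fg; pose q := (Re w, Im w).
have := cintegrableZ ((gauss_weight q)%:C)^-1 (slice_z q fock1 fg).
congr cintegrable; apply/funext => p; rewrite /integrand /= ReIm mulr1.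
by rewrite -(mulrA (gauss_weight p)%:C) mulrCA mulKf.
Qed.

Lemma fock_dot_opST f g : fock f -> fock g ->
  fock_dot (opST s t f) g =
  fock_dot f (fun w => ((sqrtc s)^-1)^* *
    gauss_cintegral (fun z => kexp s^* (- t) w z * g z)).
Proof.
move=> ff fg; set c := (sqrtc s)^-1.
(* The constant of the kernel is moved into [f], because [swap] concerns [kexp]. *)
have fcf : fock (fun z => c * f z) by exact: fockZ.
transitivity (cintegral area (fun p : RR =>
    cintegral area (fun q : RR => integrand (fun z => c * f z) g (p, q)))).
  apply: cintegral_ext => p.
  have iw := cintegrable_kexp_r (p.1 +i* p.2) fcf.
  transitivity (cintegral area (fun q : RR =>
    ((gauss_weight p)%:C * (g (p.1 +i* p.2))^* ) *
    ((gauss_weight q)%:C * (kexp s t (p.1 +i* p.2) (q.1 +i* q.2) *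
      (c * f (q.1 +i* q.2)))))); last first.
    by apply: cintegral_ext => q; rewrite /integrand /=; ring.
  rewrite (cintegralZ _ iw) -mulrA [_^* * _]mulrC; congr (_ * (_ * _)).
  by apply: cintegral_ext => q; rewrite kernelSTE -/c; ring.
rewrite (swap fcf fg); apply: cintegral_ext => q.
have iz := cintegrable_kexp_l (q.1 +i* q.2) fg.
rewrite conjC_mul conjCK /gauss_cintegral -cintegralJ; last first.
  have := cintegrableJ iz; congr cintegrable; apply/funext => p.
  by rewrite !conjC_mul conjC_real conjCK kexpJ.
transitivity (cintegral area (fun p : RR =>
    ((gauss_weight q)%:C * f (q.1 +i* q.2) * c) *
    ((gauss_weight p)%:C * (kexp s t (p.1 +i* p.2) (q.1 +i* q.2) *
      (g (p.1 +i* p.2))^* )))).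
  by apply: cintegral_ext => p; rewrite /integrand /=; ring.
rewrite (cintegralZ _ iz) -!mulrA; congr (_ * (_ * (_ * _))).
apply: cintegral_ext => p.
have -> : kexp s t (p.1 +i* p.2) (q.1 +i* q.2) =
    (kexp s^* (- t) (q.1 +i* q.2) (p.1 +i* p.2))^* by rewrite -kexpJ conjCK.
by rewrite !conjC_mul conjC_real.
Qed.

End KernelFubini.

(** * Classical Hermite polynomials and the integral Q_n *)

Section HermiteIntegral.
Context {R : realType}.
Local Notation mu := (@lebesgue_measure R).

(** One more derivative adds the Appell term and the factor -2x of the Gaussian, which together are
    minus the recurrence [hpS] with parameter -2. *)
Lemma derive1n_gauss n (x : R) :
  derive1n n (fun y : R => expR (- y ^+ 2)) x =
  (-1) ^+ n * hp (-2) (2 * x) n * expR (- x ^+ 2).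
Proof.
elim: n x => [|n IH] x; first by rewrite expr0 /= !mul1r.
rewrite derive1nS (_ : derive1n n _ =
  (fun x => (-1) ^+ n * (hp (-2) (2 * x) n * expR (- x ^+ 2)))); last first.
  by apply/funext => y; rewrite IH mulrA.
have dh : is_derive x 1 (fun y : R => hp (-2) (2 * y) n)
    (n%:R * 2 * hp (-2) (2 * x) n.-1).
  (* The real derivative is read off as the real part of [is_cderive_hp]. *)
  have hE m (y : R) : hp (-2) (2 * y%:C + 0) m = (hp (-2) (2 * y) m)%:C.
    rewrite (hp_rmorph (real_complex R)) addr0; congr hp.
      by rewrite rmorphN /= (rmorph_nat (real_complex R)).
    by rewrite rmorphM /= (rmorph_nat (real_complex R)).
  have [h _] := @is_cderive_hp R (-2) 2 0 n x.
  move: h; under [fun y => Re _]funext do rewrite hE; rewrite hE.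
  move=> h; apply: is_derive_eq h _.
  by rewrite -!(rmorph_nat (real_complex R)) -!rmorphM.
have dg : is_derive x 1 (fun y : R => expR (- y ^+ 2)) (- (2 * x) * expR (- x ^+ 2)).
  have q : is_derive x 1 (fun y : R => - y ^+ 2) (- (2 * x)).
    have h := is_deriveN (is_deriveM (is_derive_id x (1 : R)) (is_derive_id x (1 : R))).
    by apply: (is_derive_eq h); rewrite /GRing.scale /=; ring.
  have h := @is_derive1_comp _ expR (fun y : R => - y ^+ 2) _ _ _ (is_derive_expR _) q.
  by apply: (is_derive_eq h); rewrite mulrC.
have [_] := is_deriveM dh dg; rewrite -derive1E => dhg.
have [dM _] := is_deriveM dh dg.
rewrite derive1Ml // [X in _ * X]dhg hpS (exprS (-1)) /GRing.scale /=; ring.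
Qed.

Lemma hermiteE n (x : R) : hermite n x = hp (-2) (2 * x) n.
Proof.
rewrite /hermite derive1n_gauss.
transitivity (((-1) ^+ n * (-1) ^+ n) * (expR (x ^+ 2) * expR (- x ^+ 2)) *
  hp (-2) (2 * x) n); first by ring.
by rewrite -expRD subrr expR0 mulr1 -expr2 sqrr_sign mul1r.
Qed.

Lemma QintegrandE n (nu b z : R[i]) x :
  Qintegrand n nu b z x = cexp (- (nu * (b * z) ^+ 2)) *
    (hp (-2) (2 * x%:C + 0) n * cgauss nu (2 * nu * b * z) x).
Proof.
rewrite /Qintegrand hermiteE (hp_rmorph (real_complex R)) addr0.
rewrite rmorphN rmorphM /= !(rmorph_nat (real_complex R)) [RHS]mulrCA; congr (_ * _).
by rewrite /cgauss -cexpD; congr cexp; ring.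
Qed.

Lemma cintegrable_Qintegrand n (nu b z : R[i]) : 0 < Re nu ->
  cintegrable mu (Qintegrand n nu b z).
Proof.
move=> nu0; have := @cintegrable_hp_cgauss R (fun=> 1) nu (2 * nu * b * z) (-2) 2 0 n nu0
  (subgaussian_cst _) (cmeasurable_cst _ _).
move/(cintegrableZ (cexp (- (nu * (b * z) ^+ 2)))); congr cintegrable.
by apply/funext => x; rewrite QintegrandE mul1r.
Qed.

(** Integration turns the parameter -2 into [-2 + 2 / nu] at the point [2 * b * z]. The hypothesis
    on [k] is what [hp_scale] needs to return to [z], and the exponentials in [z] cancel. *)
Lemma QfunE n (nu b k z : R[i]) : 0 < Re nu -> (2 * b) ^+ 2 * k = - 2 + 2 / nu ->
  Qfun n nu b z = cintegral mu (cgauss nu 0) * (2 * b) ^+ n * hp k z n.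
Proof.
move=> nu0 kE; have nun0 : nu != 0 by apply: contraTneq nu0 => ->; rewrite ltxx.
have ih : cintegrable mu (fun x : R =>
    hp (-2) (2 * x%:C + 0) n * cgauss nu (2 * nu * b * z) x).
  have := @cintegrable_hp_cgauss R (fun=> 1) nu (2 * nu * b * z) (-2) 2 0 n nu0
    (subgaussian_cst _) (cmeasurable_cst _ _).
  by under [fun x => _]funext do rewrite mul1r.
transitivity (cintegral mu (fun x : R => cexp (- (nu * (b * z) ^+ 2)) *
    (hp (-2) (2 * x%:C + 0) n * cgauss nu (2 * nu * b * z) x))).
  by apply: cintegral_ext => x; rewrite QintegrandE.
rewrite (cintegralZ _ ih) (cintegral_hp_cgauss _ _ _ _ _ nu0) (cintegral_cgaussB _ nu0).
have -> : -2 + 2 ^+ 2 / (2 * nu) = (2 * b) ^+ 2 * k by rewrite kE; field.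
have -> : 0 + 2 * (2 * nu * b * z) / (2 * nu) = 2 * b * z by field.
rewrite hp_scale; have eE : cexp (- (nu * (b * z) ^+ 2)) *
    cexp ((2 * nu * b * z) ^+ 2 / (4 * nu)) = 1.
  by rewrite -cexpD -[RHS]cexp0; congr cexp; field.
transitivity ((cexp (- (nu * (b * z) ^+ 2)) * cexp ((2 * nu * b * z) ^+ 2 / (4 * nu))) *
  (cintegral mu (cgauss nu 0) * (2 * b) ^+ n * hp k z n)); first by ring.
by rewrite eE mul1r.
Qed.

Lemma hp_poly (c k : R[i]) n : c != 0 -> exists p : {poly R[i]},
  size p = n.+1 /\ forall z : R[i], c * hp k z n = p.[z].
Proof.
move=> c0; exists (c *: hp k%:P 'X n); split; first by rewrite size_scale // size_hp.
move=> z; rewrite hornerZ; congr (_ * _).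
by rewrite -[RHS]/(horner_eval z _) hp_rmorph /= /horner_eval hornerC hornerX.
Qed.

End HermiteIntegral.

(** * The eigenfunctions and eigenvalues in terms of [hpgauss] *)

Section Eigenfunction.
Context {R : realType}.

Definition eigen_root (s t ga : R[i]) : R[i] := (normc s ^+ 2)%:C + ga * (s * t)^*.

(** The fixed point of the affine map of T^* T on [k], whose slope is (a / |s|)^4, after cancelling
    a^2 - |s|^2. *)
Definition eigen_kappa (s t ga : R[i]) : R[i] :=
  (s * t)^* * eigen_root s t ga / (eigen_root s t ga ^+ 2 + (normc s ^+ 2)%:C).

Variables (s t ga : R[i]).
Hypothesis hst : normc t ^+ 2 + 1 < normc s ^+ 2.
Hypothesis ga1 : normc ga < 1.
Hypothesis ga_eq : (s * t)^* * ga ^+ 2 +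
  ((normc s ^+ 2)%:C + (normc t ^+ 2)%:C + 1) * ga + s * t = 0.

Let s0 : s != 0. Proof. exact: kernel_s_neq0 hst. Qed.

Let sJ : s * s^* = (normc s ^+ 2)%:C.
Proof. by rewrite -normCK normcE -rmorphXn. Qed.

Let tJ : t * t^* = (normc t ^+ 2)%:C.
Proof. by rewrite -normCK normcE -rmorphXn. Qed.

Let sJ0 : s^* != 0. Proof. by rewrite conjC_eq0. Qed.

Lemma normc_lt_ts : normc t < normc s.
Proof.
rewrite -(ltr_pXn2r (n := 2)) ?nnegrE ?normc_ge0 //.
by apply: lt_trans hst; rewrite ltrDl.
Qed.

(** The equation for gamma times [(s * t)^*] is a quadratic in X with real coefficients. Its
    imaginary part is [Im X] times 2 Re X + |s|^2 + |t|^2 + 1, at least (|s| - |t|)^2 + 1 > 0. *)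
Lemma eigen_real : exists x : R, [/\ ga * (s * t)^* = x%:C,
  x ^+ 2 + (normc s ^+ 2 + normc t ^+ 2 + 1) * x + normc s ^+ 2 * normc t ^+ 2 = 0
  & `|x| <= normc s * normc t].
Proof.
set X := ga * _; set S := normc s ^+ 2; set T := normc t ^+ 2.
have XE : X * X + (S + T + 1)%:C * X + (S * T)%:C = 0.
  have -> : (S + T + 1)%:C = s * s^* + t * t^* + 1.
    by rewrite sJ tJ !(rmorphD (real_complex R)) rmorph1.
  have -> : (S * T)%:C = s * s^* * (t * t^* ) by rewrite sJ tJ (rmorphM (real_complex R)).
  transitivity ((s * t)^* * ((s * t)^* * ga ^+ 2 + (s * s^* + t * t^* + 1) * ga + s * t)).
    by rewrite /X conjC_mul; ring.
  by rewrite sJ tJ ga_eq mulr0.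
have nX : normc X <= normc s * normc t.
  rewrite /X normcM normcJ normcM ler_piMl ?mulr_ge0 ?normc_ge0 //; exact: ltW.
clearbody X; have rX : `|Re X| <= normc s * normc t by rewrite (le_trans (normc_Re_le _)).
have ImX : Im X = 0.
  have := congr1 (@complex.Im R) XE; rewrite !reimE /= => h.
  have /eqP : Im X * (2 * Re X + (S + T + 1)) = 0 by apply: etrans h; ring.
  rewrite mulf_eq0 => /orP[/eqP //|]; rewrite gt_eqF //.
  have := sqr_ge0 (normc s - normc t); move: rX; rewrite ler_norml => /andP[h1 _].
  rewrite /S /T; nra.
have XR : X = (Re X)%:C by apply: complexP.
exists (Re X); split => //.
have := congr1 (@complex.Re R) XE; rewrite !reimE /= ImX => h.
by apply: etrans h; ring.
Qed.

Local Notation a := (eigen_root s t ga).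

(** The quadratic for X, rewritten for |s|^2 + X, shows [a0 ^+ 2] as |s|^2 plus a positive term. The
    last clause serves [0 < Re nu], with the real part of [(s * t)^*] for [y]. *)
Lemma eigen_a : exists2 a0 : R, a = a0%:C &
  [/\ normc s < a0, a0 ^+ 2 = (normc s ^+ 2 - normc t ^+ 2 - 1) * a0 + normc s ^+ 2
    & forall y, y <= normc s * normc t ->
      (Re (ga * (s * t)^*) + y) * a0 < 2 * (a0 ^+ 2 + normc s ^+ 2)].
Proof.
have [x [xE xq xb]] := eigen_real.
have ts := normc_lt_ts; have t0 := normc_ge0 t.
have sp : 0 < normc s by rewrite normc_gt0.
exists (normc s ^+ 2 + x); first by rewrite /eigen_root xE rmorphD.
move: xb; rewrite ler_norml => /andP[x1 x2].
have a0 : 0 < normc s ^+ 2 + x by nra.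
have aq : (normc s ^+ 2 + x) ^+ 2 =
    (normc s ^+ 2 - normc t ^+ 2 - 1) * (normc s ^+ 2 + x) + normc s ^+ 2.
  by apply/eqP; rewrite -subr_eq0 -xq; apply/eqP; ring.
split => //.
  rewrite -(ltr_pXn2r (n := 2)) ?nnegrE ?normc_ge0 ?ltW // aq ltrDr mulr_gt0 //.
  by rewrite -addrA -opprD subr_gt0.
move=> y yb; rewrite xE /=.
have h1 : x + y <= normc s ^+ 2 + x by nra.
have h2 : (x + y) * (normc s ^+ 2 + x) <= (normc s ^+ 2 + x) ^+ 2.
  by rewrite expr2 ler_pM2r.
have h3 : 0 < (normc s ^+ 2 + x) ^+ 2 by rewrite exprn_gt0.
have h4 : 0 < normc s ^+ 2 by rewrite exprn_gt0.
lra.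
Qed.

Local Notation k := (eigen_kappa s t ga).

Lemma absopST_sq_hpgauss (C : R[i]) n :
  absopST_sq s t (fun z => C * hpgauss k ga n z) =
  fun z => ((normc s)%:C / a) ^+ (2 * n + 1) * (C * hpgauss k ga n z).
Proof.
have [a0 aE [as0 aq _]] := eigen_a.
have sp : 0 < normc s by rewrite normc_gt0.
have ap : 0 < a0 by exact: lt_trans as0.
have an0 : a != 0 by rewrite aE eq_complex /= gt_eqF.
pose d : R := a0 / normc s ^+ 2.
have d0 : 0 < d by rewrite divr_gt0 // exprn_gt0.
have dE : d%:C = a / (s * s^*) by rewrite sJ aE -fmorphV -rmorphM.
have aE1 : a = s * s^* + ga * (s^* * t^*) by rewrite /eigen_root conjC_mul sJ.
have gaE : s^* * t^* * ga ^+ 2 + (s * s^* + t * t^* + 1) * ga + s * t = 0.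
  by rewrite -conjC_mul sJ tJ.
have S2 : a ^+ 2 + s * s^* != 0.
  rewrite sJ aE -rmorphXn -rmorphD eq_complex /= gt_eqF // addr_gt0 // exprn_gt0 //.
have kE : k = s^* * t^* * a / (a ^+ 2 + s * s^*) by rewrite /eigen_kappa sJ conjC_mul.
have a2 : a ^+ 2 = (s * s^* - t * t^* - 1) * a + s * s^*.
  by rewrite sJ tJ aE -rmorphXn aq !(rmorphD, rmorphN, rmorphM, rmorph1).
have be1 : normc (t^* / s) < 1.
  by rewrite normcM normcJ Normc.normcV ltr_pdivrMr // mul1r normc_lt_ts.
have be2 : normc ((- t)^* / s^*) < 1.
  by rewrite normcM !normcJ normcN Normc.normcV normcJ ltr_pdivrMr // mul1r normc_lt_ts.
have d1 : d%:C = 1 + t^* / s * ga.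
  by rewrite dE aE1; field; rewrite s0 sJ0.
pose ga' := t / s + ga / (s ^+ 2 * d%:C).
have ga'E : ga' = - (ga * s^* / s).
  rewrite /ga' dE; apply/eqP; rewrite -subr_eq0; apply/eqP.
  (* The difference of the two sides is a multiple of the equation for gamma. The resulting form of
     [ga'] shows that it has the modulus of [ga], so the second integral converges as well. *)
  transitivity (s^* / (s * a) *
    (s^* * t^* * ga ^+ 2 + (s * s^* + t * t^* + 1) * ga + s * t)); last first.
    by rewrite gaE mulr0.
  have -> : t / s + ga / (s ^+ 2 * (a / (s * s^*))) - - (ga * s^* / s) =
      (t * a + ga * s^* + ga * s^* * a) / (s * a) by field; rewrite s0 sJ0 an0.
  by rewrite [in t * a]aE1 [in ga * s^* * a]aE1; field; rewrite s0 an0.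
have ga'1 : normc ga' < 1.
  rewrite ga'E normcN !normcM Normc.normcV normcJ mulfK //.
  by rewrite gt_eqF.
(* The adjoint kernel at [ga'] has the same determinant, so both integrals give the factor 1 / sqrt
   d. *)
have d2 : d%:C = 1 + (- t)^* / s^* * ga'.
  by rewrite d1 ga'E rmorphN /=; field; rewrite s0 sJ0.
pose k' := (s * d%:C) ^+ 2 * (k - t^* / (s * d%:C)).
have k2 : (s^* * d%:C) ^+ 2 * (k' - (- t)^* / (s^* * d%:C)) = k.
  by rewrite /k' rmorphN /= kE dE; field; rewrite s0 sJ0 an0 S2.
have g2 : - t / s^* + ga' / (s^* ^+ 2 * d%:C) = ga.
  rewrite ga'E dE; apply/eqP; rewrite -subr_eq0; apply/eqP.
  transitivity (- s^* / (s^* * a) *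
    (s^* * t^* * ga ^+ 2 + (s * s^* + t * t^* + 1) * ga + s * t)); last first.
    by rewrite gaE mulr0.
  have -> : - t / s^* + - (ga * s^* / s) / (s^* ^+ 2 * (a / (s * s^*))) - ga =
      - (t * a + ga * s^* + ga * s^* * a) / (s^* * a) by field; rewrite s0 sJ0 an0.
  by rewrite [in t * a]aE1 [in ga * s^* * a]aE1; field; rewrite sJ0 an0.
pose c := (sqrtc s)^-1.
pose C1 := c * C * ((Num.sqrt d)^-1%:C * ((s * d%:C) ^+ n)^-1).
have TE : opST s t (fun z => C * hpgauss k ga n z) = fun z => C1 * hpgauss k' ga' n z.
  apply/funext => z.
  have := gauss_cintegral_kexp k z n s0 be1 ga1 d0 d1; rewrite -/k' -/ga' => h.
  rewrite /C1 -mulrA -h -gauss_cintegralZ.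
    congr gauss_cintegral; apply/funext => w; rewrite kernelSTE -/c.
    by rewrite mulrACA.
  apply: (cintegrable_kexp_r hst).
  by have := @fock_hpgauss R 1 k ga n ga1; under [fun z => _]funext do rewrite mul1r.
have f1 : fock (fun z => C1 * hpgauss k' ga' n z) by exact: fock_hpgauss.
have f2 : fock (fun z => ((normc s)%:C / a) ^+ (2 * n + 1) * (C * hpgauss k ga n z)).
  by apply: fockZ; exact: fock_hpgauss.
rewrite /absopST_sq TE; apply: fock_adjointE => // F fF.
rewrite (fock_dot_opST hst fF f1); congr fock_dot; apply/funext => w.
have hst' : normc (- t) ^+ 2 + 1 < normc s^* ^+ 2 by rewrite normcN normcJ.
have -> : gauss_cintegral (fun z => kexp s^* (- t) w z * (C1 * hpgauss k' ga' n z)) =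
    C1 * gauss_cintegral (fun z => kexp s^* (- t) w z * hpgauss k' ga' n z).
  rewrite -gauss_cintegralZ; first by congr gauss_cintegral; apply/funext => z; rewrite mulrCA.
  apply: (cintegrable_kexp_r hst').
  by have := @fock_hpgauss R 1 k' ga' n ga'1; under [fun z => _]funext do rewrite mul1r.
rewrite (gauss_cintegral_kexp k' w n sJ0 be2 ga'1 d0 d2) k2 g2.
have sC0 : (normc s)%:C != 0 by rewrite eq_complex /= gt_eqF.
have cc : c * c^* = (normc s)%:C^-1.
  rewrite -normCK normcE -rmorphXn -fmorphV /c Normc.normcV exprVn; congr (_^-1)%:C.
  by rewrite -normcX sqr_sqrtc.
have dd : (Num.sqrt d)^-1%:C * (Num.sqrt d)^-1%:C = (d%:C)^-1.
  by rewrite -rmorphM -expr2 exprVn sqr_sqrtr ?ltW // fmorphV.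
have nn : ((s * d%:C) ^+ n)^-1 * ((s^* * d%:C) ^+ n)^-1 = (((normc s)%:C / a) ^+ 2) ^+ n.
  rewrite -invfM -exprMn -exprVn; congr (_ ^+ n).
  have sE : s = (normc s)%:C ^+ 2 / s^* by rewrite -(rmorphXn (real_complex R)) /= -sJ mulfK.
  rewrite dE sJ rmorphXn /= {1}sE; field.
  by rewrite sC0 sJ0 an0.
(* The three factors are 1 / |s|, 1 / d = |s|^2 / a and (|s| / a)^(2n). *)
have key : (c * c^* ) * ((Num.sqrt d)^-1%:C * (Num.sqrt d)^-1%:C) *
    (((s * d%:C) ^+ n)^-1 * ((s^* * d%:C) ^+ n)^-1) = ((normc s)%:C / a) ^+ (2 * n + 1).
  rewrite cc dd nn exprD expr1 exprM dE sJ rmorphXn /= [RHS]mulrC; congr (_ * _).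
  by field; rewrite sC0 an0.
by rewrite -key /C1; ring.
Qed.

End Eigenfunction.

Theorem theorem15 (R : realType) (s t gamma : R[i])
    (hst : `|t| ^+ 2 + 1 < `|s| ^+ 2)
    (hgamma : `|gamma| < 1)
    (gamma_eq : (s * t)^* * gamma ^+ 2
      + (`|s| ^+ 2 + `|t| ^+ 2 + 1) * gamma + s * t = 0)
    (n : nat) :
  let a := `|s| ^+ 2 + gamma * (s * t)^* in
  let lambda := (`|s| / a) ^+ (2 * n + 1) in
  let nu :=
    (a ^+ 2 * (a ^+ 2
       + (gamma + 1) * (s * t)^* * (`|t| ^+ 2 + 1 - `|s| ^+ 2) / 2)
     - `|s| ^+ 4) / (a ^+ 4 - `|s| ^+ 4) in
  let b := sqrtc (gamma + 1) / (2 * sqrtc nu) in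
  [/\ 0 < lambda,
      fock_eigenvalue (absopST_sq s t) lambda,
      fock_eigenvector (absopST_sq s t) lambda
        (fun z => Qfun n nu b z * cexp (gamma * z ^+ 2 / 2)),
      forall z : R[i], cintegrable (@lebesgue_measure R) (Qintegrand n nu b z)
    & exists p : {poly R[i]},
        size p = n.+1 /\ forall z : R[i], Qfun n nu b z = p.[z] ].
Proof.
move=> a lambda nu b.
have realX (x : R) m : (x ^+ m)%:C = x%:C ^+ m by rewrite rmorphXn.
have hst' : normc t ^+ 2 + 1 < normc s ^+ 2.
  by move: hst; rewrite !normcE -!realX -(rmorph1 (real_complex R)) -rmorphD ltcR.
have ga1 : normc gamma < 1.
  by move: hgamma; rewrite normcE -(rmorph1 (real_complex R)) ltcR.
have ga_eq : (s * t)^* * gamma ^+ 2 +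
    ((normc s ^+ 2)%:C + (normc t ^+ 2)%:C + 1) * gamma + s * t = 0.
  by rewrite !realX -!normcE.
have aE : a = eigen_root s t gamma by rewrite /eigen_root realX -normcE.
have [a0 aR [as0 aq aRe]] := eigen_a hst' ga1 ga_eq.
have s0 := kernel_s_neq0 hst'.
have sp : 0 < normc s by rewrite normc_gt0.
have ap : 0 < a0 by exact: lt_trans as0.
have an0 : a0%:C != 0 by rewrite eq_complex /= gt_eqF.
have aS : 0 < a0 ^+ 2 - normc s ^+ 2.
  by rewrite subr_gt0 ltr_pXn2r // ?nnegrE ltW.
have aSC : a0%:C ^+ 2 - (normc s)%:C ^+ 2 != 0.
  by rewrite -!realX -rmorphB eq_complex /= gt_eqF.
have aS2C : a0%:C ^+ 2 + (normc s)%:C ^+ 2 != 0.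
  by rewrite -!realX -rmorphD eq_complex /= gt_eqF // addr_gt0 // exprn_gt0.
set k := eigen_kappa s t gamma.
have kE : k = (s * t)^* * a0%:C / (a0%:C ^+ 2 + (normc s)%:C ^+ 2).
  by rewrite /k /eigen_kappa aR realX.
have nuE : nu = 1 - (gamma + 1) * k / 2.
  rewrite /nu aE aR kE !normcE.
  (* The equation for [a0] rewritten; it puts a^2 - |s|^2 in the numerator of [nu], where it cancels
     against the denominator. *)
  have -> : (normc t)%:C ^+ 2 + 1 - (normc s)%:C ^+ 2 =
      - ((a0%:C ^+ 2 - (normc s)%:C ^+ 2) / a0%:C).
    apply: (mulIf an0); rewrite mulNr divfK // -!realX.
    rewrite -(rmorph1 (real_complex R)) -!(rmorphD, rmorphB, rmorphM, rmorphN) /=.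
    by congr (_%:C); rewrite aq; ring.
  have -> : a0%:C ^+ 4 - (normc s)%:C ^+ 4 =
    (a0%:C ^+ 2 - (normc s)%:C ^+ 2) * (a0%:C ^+ 2 + (normc s)%:C ^+ 2) by ring.
  by field; rewrite an0 aSC aS2C.
have nu0 : 0 < Re nu.
  have kR : (gamma + 1) * k / 2 = (gamma * (s * t)^* + (s * t)^* ) *
      (a0 / (2 * (a0 ^+ 2 + normc s ^+ 2)))%:C.
    rewrite kE (fmorph_div (real_complex R)) (rmorphM (real_complex R) 2).
    rewrite (rmorphD (real_complex R) (a0 ^+ 2)) !(rmorphXn (real_complex R)).
    by rewrite (rmorph_nat (real_complex R)); field; rewrite aS2C.
  rewrite nuE ReD ReN kR ReM /= mulr0 subr0 subr_gt0 ReD mulrA.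
  rewrite ltr_pdivrMr ?mul1r ?mulr_gt0 ?addr_gt0 ?exprn_gt0 //.
  apply: aRe; rewrite (le_trans (ler_norm _)) // (le_trans (normc_Re_le _)) //.
  by rewrite normcJ normcM.
have nun0 : nu != 0 by apply: contraTneq nu0 => ->; rewrite ltxx.
have g10 : gamma + 1 != 0.
  apply: contraTneq hgamma => /eqP; rewrite addr_eq0 => /eqP ->.
  by rewrite normrN normr1 ltxx.
(* Squaring removes the choice of both roots; [bk] then holds by the formula [nuE]. *)
have b2 : (2 * b) ^+ 2 = (gamma + 1) / nu.
  have sn : sqrtc nu != 0 by rewrite sqrtc_eq0.
  transitivity (sqrtc (gamma + 1) ^+ 2 / sqrtc nu ^+ 2); first by rewrite /b; field.
  by rewrite !sqr_sqrtc.
have bn0 : 2 * b != 0.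
  have : (2 * b) ^+ 2 != 0 by rewrite b2 mulf_neq0 // invr_neq0.
  by rewrite expf_eq0.
have bk : (2 * b) ^+ 2 * k = - 2 + 2 / nu.
  rewrite b2; have -> : - 2 + 2 / nu = (2 - 2 * nu) / nu by field.
  have -> : 2 - 2 * nu = (gamma + 1) * k by rewrite nuE; field.
  by rewrite mulrAC.
set C := cintegral (@lebesgue_measure R) (cgauss nu 0) * (2 * b) ^+ n.
have C0 : C != 0 by rewrite mulf_neq0 ?expf_neq0 // cintegral_cgauss_neq0.
have QE z : Qfun n nu b z = C * hp k z n by rewrite (QfunE _ _ nu0 bk).
have fE : (fun z => Qfun n nu b z * cexp (gamma * z ^+ 2 / 2)) =
    (fun z => C * hpgauss k gamma n z).
  by apply/funext => z; rewrite QE -mulrA.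
have [p [sp' pE]] := hp_poly k n C0.
have ev : fock_eigenvector (absopST_sq s t) lambda
    (fun z => Qfun n nu b z * cexp (gamma * z ^+ 2 / 2)).
  split.
  - by rewrite fE; exact: fock_hpgauss.
  - rewrite fE => f0.
    (* The exponential has no zeros, so [p] would vanish at the [size p] distinct points 0, 1, ...,
       n. *)
    have p0 : p = 0.
      apply: (@roots_geq_poly_eq0 _ p [seq i%:R | i <- iota 0 (size p)]).
      + apply/allP => z _; rewrite /root -pE.
        have /eqP := congr1 (fun u => u z) f0; rewrite mulrA mulf_eq0.
        by rewrite (negbTE (cexp_neq0 _)) orbF.
      + by rewrite map_inj_uniq ?iota_uniq // => i j /eqP; rewrite eqr_nat => /eqP.
      + by rewrite size_map size_iota.
    by move: sp'; rewrite p0 size_poly0.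
  - rewrite fE (absopST_sq_hpgauss hst' ga1 ga_eq); apply/funext => z.
    by rewrite /lambda aE normcE QE /hpgauss -/k (mulrA C).
split => //.
- rewrite /lambda aE aR normcE -fmorph_div -rmorphXn ltcR.
  by rewrite exprn_gt0 // divr_gt0.
- by exists (fun z => Qfun n nu b z * cexp (gamma * z ^+ 2 / 2)).
- by move=> z; exact: cintegrable_Qintegrand.
- by exists p; split => // z; rewrite QE pE.
Qed.
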